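(* Let $n\ge0$ be an integer and $\Lambda_n=\{k\in\mathbb{Z}:|k|\le n\}$. With the notation of the context, \[ \min_{\rho\in\mathcal{S}(\mathcal{K}_{\Lambda_n})}\min_{M\in\mathcal{M}_{\mathrm{cov}}(\mathrm{U}(1))}\mathcal{D}_R(\rho,M) =\min_{\{p_i\}}\min_{\rho_i\in\mathcal{S}(\mathcal{K}_{\Lambda_n})}\min_{M_i\in\mathcal{M}_{\mathrm{cov}}(\mathrm{U}(1))}\sum_ip_i\mathcal{D}_R(\rho_i,M_i) =\min_{\phi\in\mathcal{K}_{\Lambda_n},\|\phi\|=1}\mathcal{D}_R(|\phi\rangle)=1-\cos\frac{\pi}{2n+2}. \] The minimum $1-\cos\frac{\pi}{2n+2}$ is attained by an input state $|\phi\rangle=\sum_{\lambda=-n}^n\phi(\lambda)|\lambda\rangle$ with the measurement $M_{|\mathcal{I}\rangle\langle\mathcal{I}|}$ if and only if $\phi(\lambda)=C\sin\frac{\pi(\lambda+n+1)}{2n+2}$ for $\lambda=-n,\dots,n$, with $C$ the normalizing constant.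
   Context: $\mathrm{U}(1)\cong(-\pi,\pi]$ with Haar measure $d\theta/2\pi$. $\mathcal{K}_{\Lambda_n}=\mathrm{span}\{|k\rangle:|k|\le n\}\subset\ell^2(\mathbb{Z})$ with orthonormal basis $|k\rangle$; $\theta$ acts by $f(\theta)=\sum_ke^{ik\theta}|k\rangle\langle k|$. The risk is $R(\theta,\hat\theta)=1-\cos(\hat\theta-\theta)$. $\mathcal{D}_R(\rho,M)=\sup_\theta\int R(\theta,\hat\theta)\mathrm{Tr}[f(\theta)\rho f(\theta)^\dagger M(d\hat\theta)]$ for states $\rho$ and POVMs $M$ on $(-\pi,\pi]$; $\mathcal{M}_{\mathrm{cov}}(\mathrm{U}(1))$ is the set of POVMs with $f(\theta)M(B)f(\theta)^\dagger=M(B+\theta)$; $\{p_i\}$ ranges over probability distributions. For $\phi=\sum\phi(k)|k\rangle$, $\mathcal{F}^{-1}[\phi](\theta)=\sum_ke^{-ik\theta}\phi(k)$ and $\mathcal{D}_R(|\phi\rangle)=\int_{-\pi}^{\pi}(1-\cos\hat\theta)|\mathcal{F}^{-1}[\phi](\hat\theta)|^2\frac{d\hat\theta}{2\pi}$. $M_{|\mathcal{I}\rangle\langle\mathcal{I}|}$ is the covariant POVM $M(B)=\int_Bf(\theta)|\mathcal{I}\rangle\langle\mathcal{I}|f(\theta)^\dagger\frac{d\theta}{2\pi}$ with $|\mathcal{I}\rangle=\sum_{|k|\le n}|k\rangle$; one has $\mathcal{D}_R(|\phi\rangle\langle\phi|,M_{|\mathcal{I}\rangle\langle\mathcal{I}|})=\mathcal{D}_R(|\phi\rangle)$.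 *)

(* Defs.v *)
From HB Require Import structures.
From mathcomp Require Import all_boot all_order all_algebra.
From mathcomp Require Import all_classical all_reals all_analysis.
From mathcomp Require Import complex.
Set Implicit Arguments. Unset Strict Implicit. Unset Printing Implicit Defensive.
Import Order.TTheory GRing.Theory Num.Theory.
Import numFieldNormedType.Exports.
Local Open Scope classical_set_scope.
Local Open Scope ring_scope.

(* The Hilbert space K_{Lambda_n} = span{|k> : |k| <= n} is C^(2n+1);
   the basis index i : 'I_(2n+1) corresponds to k = i - n. *)
Definition kk (R : realType) (n : nat) (i : 'I_(n.*2.+1)) : R := i%:R - n%:R.

(* U(1) identified with (-pi, pi]. *)
Definition Omega (R : realType) : set R := [set x | - pi < x <= pi].

Definition expi (R : realType) (t : R) : R[i] := Complex (cos t) (sin t).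

Definition sqn (R : realType) (z : R[i]) : R := complex.Re z ^+ 2 + complex.Im z ^+ 2.

Definition adj (R : realType) (m p : nat) (A : 'M[R[i]]_(m, p)) : 'M[R[i]]_(p, m) :=
  \matrix_(i, j) conjc (A j i).

Definition fU (R : realType) (n : nat) (t : R) : 'M[R[i]]_(n.*2.+1) :=
  diag_mx (\row_(i < n.*2.+1) expi (@kk R n i * t)).

Definition psd (R : realType) (N : nat) (A : 'M[R[i]]_N) : Prop :=
  forall v : 'cV[R[i]]_N, 0 <= (adj v *m A *m v) 0 0.

Definition is_state (R : realType) (n : nat) (rho : 'M[R[i]]_(n.*2.+1)) : Prop :=
  psd rho /\ \tr rho = 1.

Definition outcome_measure (R : realType) (N : nat) (sigma : 'M[R[i]]_N)
    (M : set R -> 'M[R[i]]_N) (mu : {measure set R -> \bar R}) : Prop :=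
  forall B : set R, measurable B ->
    mu B = (complex.Re (\tr (sigma *m M (B `&` (@Omega R)))))%:E.

(* POVM on the Borel sets of (-pi, pi]: positive values, normalization, and
   (weak) countable additivity, expressed as: for every positive sigma the map
   B |-> Re Tr[sigma M(B)] is a measure. *)
Definition is_povm (R : realType) (N : nat) (M : set R -> 'M[R[i]]_N) : Prop :=
  [/\ forall B, measurable B -> B `<=` (@Omega R) -> psd (M B),
      M ((@Omega R)) = 1%:M &
      forall sigma : 'M[R[i]]_N, psd sigma ->
        exists mu : {measure set R -> \bar R}, outcome_measure sigma M mu].

Definition shift (R : realType) (B : set R) (t : R) : set R :=
  [set x | (@Omega R) x /\ exists b (k : int), B b /\ x = b + t + k%:~R * (2 * pi)].

Definition covariant (R : realType) (n : nat)
    (M : set R -> 'M[R[i]]_(n.*2.+1)) : Prop :=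
  is_povm M /\
  forall t B, (@Omega R) t -> measurable B -> B `<=` (@Omega R) ->
    @fU R n t *m M B *m adj (@fU R n t) = M (shift B t).

Definition DR (R : realType) (n : nat) (rho : 'M[R[i]]_(n.*2.+1))
    (M : set R -> 'M[R[i]]_(n.*2.+1)) : \bar R :=
  ereal_sup [set r | exists t (mu : {measure set R -> \bar R}),
    [/\ (@Omega R) t,
        outcome_measure (@fU R n t *m rho *m adj (@fU R n t)) M mu &
        r = (\int[mu]_(x in (@Omega R)) ((1 - cos (x - t))%:E))%E]].

Definition Finv (R : realType) (n : nat) (phi : 'cV[R[i]]_(n.*2.+1)) (t : R) : R[i] :=
  \sum_i expi (- (@kk R n i * t)) * phi i 0.

Definition DRvec (R : realType) (n : nat) (phi : 'cV[R[i]]_(n.*2.+1)) : \bar R :=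
  (((2 * pi)^-1)%:E *
    \int[lebesgue_measure]_(x in (@Omega R)) ((1 - cos x) * sqn (Finv phi x))%:E)%E.

Definition unit_vec (R : realType) (N : nat) (phi : 'cV[R[i]]_N) : Prop :=
  \sum_i sqn (phi i 0) = 1.

(* M_{|I><I|}(B) = int_B f(theta)|I><I|f(theta)^dag dtheta/2pi, |I> = sum_k |k>;
   its (j,k) entry is int_{B cap (-pi,pi]} e^{i(k_j - k_k) theta} dtheta / 2pi. *)
Definition M_I (R : realType) (n : nat) (B : set R) : 'M[R[i]]_(n.*2.+1) :=
  \matrix_(j, k)
    Complex ((2 * pi)^-1 * Rintegral lebesgue_measure (B `&` (@Omega R))
                               (fun x => cos ((@kk R n j - @kk R n k) * x)))
            ((2 * pi)^-1 * Rintegral lebesgue_measure (B `&` (@Omega R))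
                               (fun x => sin ((@kk R n j - @kk R n k) * x))).

Definition sine_state (R : realType) (n : nat) (j : 'I_(n.*2.+1)) : R :=
  sin (pi * (@kk R n j + n%:R + 1) / (n.*2.+2)%:R).

Definition minrisk (R : realType) (n : nat) : R := 1 - cos (pi / (n.*2.+2)%:R).

Definition is_prob (R : realType) (p : nat -> R) : Prop :=
  (forall i, 0 <= p i) /\ (\sum_(0 <= i <oo) (p i)%:E)%E = 1%E.

(* Main.v *)
(** With c = cos (pi / (2n+2)) and s_j = sin (pi (j+1) / (2n+2)), the recurrence
    s_(j+2) + s_j = 2 c s_(j+1) and the vanishing of s beyond both ends give
    c sum a_j^2 - sum a_j a_(j+1) = 1/2 sum (s_(j+1) a_j - s_j a_(j+1))^2 / (s_j s_(j+1)),
    so the hopping form is at most c |a|^2, with equality only on multiples of s.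

    Lower bound for a covariant M: cut (-pi, pi] into q arcs.  Covariance makes M of the
    i-th arc the conjugate by f(t_i) of M of one fixed arc, whose q-fold multiple A is
    positive with unit diagonal.  Replacing 1 - cos by its values at the points t_i costs at
    most 2 pi / q, and discrete orthogonality of the characters leaves
    1 - 1/2 Re (sum over |j-k| = 1 of rho_jk A_kj), which is bounded below by the hopping
    estimate for a_j = sqrt rho_jj.  Then q tends to infinity.

    For M_I the outcome distribution has an explicit trigonometric density, and the risk is
    evaluated exactly; for a pure state it is 1 minus the hopping form, independently of
    theta. *)

Require Import Defs.
From HB Require Import structures.
From mathcomp Require Import all_boot all_order all_algebra.
From mathcomp Require Import all_classical all_reals all_analysis.
From mathcomp Require Import measurable_realfun complex ring lra zify.
Set Implicit Arguments. Unset Strict Implicit. Unset Printing Implicit Defensive.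
Import Order.TTheory GRing.Theory Num.Theory.
Import numFieldNormedType.Exports.
Local Open Scope classical_set_scope.
Local Open Scope ring_scope.

(** * Positive matrices and the hopping form *)

(** Completing squares: each summand expands to [s j.+1 / s j * a j ^+ 2 + s j / s j.+1 * a j.+1 ^+
    2 - 2 * a j * a j.+1], and the recurrence makes the coefficients of an inner [a j ^+ 2] add up
    to [2 * c]. The hypothesis on [s 1] is the recurrence with a zero before [s 0]; the last term is
    what remains at the right end. *)
Lemma tridiag_sum_sq (F : realFieldType) (c : F) (s a : nat -> F) (m : nat) :
  s 1%N = 2 * c * s 0%N -> (forall j, s j.+2 + s j = 2 * c * s j.+1) ->
  (forall j, (j <= m)%N -> s j != 0) ->
  c * (\sum_(j < m.+1) a j ^+ 2) - \sum_(j < m) a j * a j.+1 =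
  2^-1 * (\sum_(j < m) (s j.+1 * a j - s j * a j.+1) ^+ 2 / (s j * s j.+1)
          + s m.+1 / s m * a m ^+ 2).
Proof.
move=> s1 sS; elim: m => [|m IH] s0.
  rewrite big_ord_recl !big_ord0 s1; field; exact: s0.
rewrite big_ord_recr [X in _ - X]big_ord_recr [in RHS]big_ord_recr /=.
have {}IH := IH (fun j jm => s0 j (leqW jm)).
have n0 : s m != 0 by apply: s0.
have n1 : s m.+1 != 0 by apply: s0.
have -> : s m.+2 = 2 * c * s m.+1 - s m by rewrite -sS addrK.
rewrite mulrDr opprD addrACA IH; field.
by rewrite n0 n1.
Qed.

Lemma sum_superdiag (V : nmodType) (m : nat) (F : 'I_m.+1 -> 'I_m.+1 -> V) :
  \sum_(j < m.+1) \sum_(k < m.+1) F j k *+ (k == j.+1 :> nat) =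
  \sum_(i < m) F (inord i) (inord i.+1).
Proof.
rewrite big_ord_recr /= [X in _ + X]big1 ?addr0; last first.
  by move=> k _; rewrite ltn_eqF.
apply: eq_bigr => i _; rewrite (bigD1 (inord i.+1)) //= big1 ?addr0.
  rewrite inordK ?ltnS // eqxx mulr1n; congr (F _ _).
  by apply: val_inj; rewrite /= inordK // (ltn_trans (ltn_ord i)).
move=> k ki; case: eqP => // ek; case/eqP: ki.
by apply: val_inj; rewrite /= ek inordK // ltnS.
Qed.

Lemma sum_ord_inord (V : nmodType) (m : nat) (F : 'I_m.+1 -> V) :
  \sum_(j < m.+1) F j = \sum_(j < m.+1) F (inord j).
Proof. by apply: eq_bigr => j _; rewrite inord_val. Qed.

Lemma sine_stateE (R : realType) (n : nat) (j : 'I_(n.*2.+1)) :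
  sine_state R j = sin (pi / (n.*2.+2)%:R * (j.+1)%:R).
Proof.
rewrite /sine_state /kk; congr sin.
by rewrite subrK natr1 mulrAC.
Qed.

Lemma sine_state_gt0 (R : realType) (n : nat) (j : 'I_(n.*2.+1)) :
  0 < sine_state R j.
Proof.
rewrite sine_stateE; apply: sin_gt0_pi.
rewrite mulr_gt0 ?divr_gt0 ?pi_gt0 ?ltr0n //=.
rewrite -mulrA gtr_pMr ?pi_gt0 // mulrC ltr_pdivrMr ?ltr0n // mul1r ltr_nat.
by rewrite ltnS ltn_ord.
Qed.

Lemma sine_state_sos (R : realType) (n : nat) (a : 'I_(n.*2.+1) -> R) :
  cos (pi / (n.*2.+2)%:R) * (\sum_j a j ^+ 2)
    - \sum_j \sum_k (a j * a k) *+ (k == j.+1 :> nat) =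
  2^-1 * \sum_j \sum_k
    ((sine_state R k * a j - sine_state R j * a k) ^+ 2
     / (sine_state R j * sine_state R k)) *+ (k == j.+1 :> nat).
Proof.
pose h : R := pi / (n.*2.+2)%:R.
pose s (j : nat) := sin (h * (j.+1)%:R).
have sE (j : nat) : (j <= n.*2)%N -> @sine_state R n (inord j) = s j.
  by move=> jn; rewrite sine_stateE inordK.
rewrite !sum_superdiag (sum_ord_inord (fun j => a j ^+ 2)).
rewrite (@tridiag_sum_sq R (cos h) s (fun j => a (inord j)) n.*2).
(* The boundary term vanishes: one index past the end the sine is [sin pi]. *)
- have -> : s n.*2.+1 = 0.
    by rewrite /s /h divfK ?sinpi // pnatr_eq0.
  rewrite mul0r mul0r addr0; congr (_ * _); apply: eq_bigr => i _.
  by rewrite !sE // ltnW.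
- by rewrite /s mulr1 mulr_natr sin_mulr2n mulr_natl mulrnAl.
- move=> j; rewrite /s.
  have -> : h * j.+3%:R = h * j.+2%:R + h by rewrite -[j.+3]addn1 natrD mulrDr mulr1.
  have -> : h * j.+1%:R = h * j.+2%:R - h by rewrite -[j.+2]addn1 natrD mulrDr mulr1 addrK.
  rewrite sinD sinB; ring.
- by move=> j jn; rewrite -sE // gt_eqF ?sine_state_gt0.
Qed.

Lemma sine_state_tridiag_le (R : realType) (n : nat) (a : 'I_(n.*2.+1) -> R) :
  \sum_j \sum_k (a j * a k) *+ (k == j.+1 :> nat) <=
  cos (pi / (n.*2.+2)%:R) * (\sum_j a j ^+ 2).
Proof.
rewrite -subr_ge0 sine_state_sos mulr_ge0 ?invr_ge0 ?ler0n //.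
apply: sumr_ge0 => j _; apply: sumr_ge0 => k _; rewrite mulrn_wge0 //.
by rewrite divr_ge0 ?sqr_ge0 // mulr_ge0 // ltW // sine_state_gt0.
Qed.

(** Equality forces every square in [sine_state_sos] to vanish, so the ratio [a j / sine_state R j]
    agrees at neighbouring indices and is constant. *)
Lemma sine_state_tridiag_eq (R : realType) (n : nat) (a : 'I_(n.*2.+1) -> R) :
  \sum_j \sum_k (a j * a k) *+ (k == j.+1 :> nat) =
    cos (pi / (n.*2.+2)%:R) * (\sum_j a j ^+ 2) <->
  exists C, forall j, a j = C * sine_state R j.
Proof.
have T0 (j k : 'I_(n.*2.+1)) : 0 <=
    ((sine_state R k * a j - sine_state R j * a k) ^+ 2
     / (sine_state R j * sine_state R k)) *+ (k == j.+1 :> nat).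
  by rewrite mulrn_wge0 // divr_ge0 ?sqr_ge0 // mulr_ge0 // ltW // sine_state_gt0.
have s0 (j : 'I_(n.*2.+1)) : sine_state R j != 0.
  by rewrite gt_eqF ?sine_state_gt0.
split=> [e|[C aE]]; last first.
  apply/esym/eqP; rewrite -subr_eq0 sine_state_sos big1 ?mulr0 // => j _.
  rewrite big1 // => k _; rewrite !aE.
  by rewrite [X in X ^+ 2](_ : _ = 0) ?expr0n ?mul0r ?mul0rn //; ring.
exists (a ord0 / @sine_state R n ord0) => j.
have /eqP : 2^-1 * \sum_j \sum_k
    ((sine_state R k * a j - sine_state R j * a k) ^+ 2
     / (sine_state R j * sine_state R k)) *+ (k == j.+1 :> nat) = 0.
  by rewrite -sine_state_sos e subrr.
rewrite mulf_eq0 invr_eq0 pnatr_eq0 /= psumr_eq0; last first.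
  by move=> i _; apply: sumr_ge0 => k _; exact: T0.
move=> /allP z.
have step (i k : 'I_(n.*2.+1)) : k = i.+1 :> nat ->
    a k / sine_state R k = a i / sine_state R i.
  move=> ki; have := z i (mem_index_enum _); rewrite psumr_eq0 //.
  move=> /allP /(_ k (mem_index_enum _)) /=; rewrite ki eqxx mulr1n.
  rewrite mulf_eq0 sqrf_eq0 invr_eq0 mulf_eq0 !(negbTE (s0 _)) /= orbF subr_eq0.
  by move=> /eqP ee; apply/eqP; rewrite eqr_div // mulrC -ee mulrC.
have H (m : nat) : (m < n.*2.+1)%N -> a (inord m) / @sine_state R n (inord m) =
    a ord0 / @sine_state R n ord0.
  elim: m => [|m IH] mn; first
    by have -> : inord 0 = ord0 :> 'I_(n.*2.+1) by apply: val_inj; rewrite /= inordK.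
  by rewrite -IH ?(ltnW mn) //; apply: step; rewrite !inordK // ltnW.
by rewrite -(H j (ltn_ord j)) inord_val divfK.
Qed.

(** * Complex phases, positive semidefinite matrices and the risk form *)

Lemma Re_sum (R : realType) (I : Type) (r : seq I) (P : pred I) (F : I -> R[i]) :
  complex.Re (\sum_(i <- r | P i) F i) = \sum_(i <- r | P i) complex.Re (F i).
Proof. by apply: (big_morph (@complex.Re R)) => // -[a b] [c d]. Qed.

Lemma complex_ReM (R : realType) (x y : R[i]) : complex.Re (x * y) =
  complex.Re x * complex.Re y - complex.Im x * complex.Im y.
Proof. by case: x; case: y. Qed.

Lemma sqnM (R : realType) (x y : R[i]) : sqn (x * y) = sqn x * sqn y.
Proof. by rewrite /sqn; case: x => a b; case: y => c d /=; ring. Qed.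

Lemma Re_le_sqrt_sqn (R : realType) (x : R[i]) : complex.Re x <= Num.sqrt (sqn x).
Proof.
rewrite (le_trans (ler_norm _)) // -sqrtr_sqr ler_wsqrtr // lerDl sqr_ge0.
by [].
Qed.

Lemma expiD (R : realType) (a b : R) : expi (a + b) = expi a * expi b.
Proof.
apply/eqP; rewrite eq_complex /= cosD sinD eqxx /=.
by apply/eqP; rewrite addrC.
Qed.

Lemma expi0 (R : realType) : expi (0 : R) = 1.
Proof. by rewrite /expi cos0 sin0. Qed.

Lemma conjc_expi (R : realType) (a : R) : conjc (expi a) = expi (- a).
Proof. by rewrite /expi /= cosN sinN. Qed.

Lemma adjM (R : realType) (m p q : nat) (A : 'M[R[i]]_(m, p)) (B : 'M[R[i]]_(p, q)) :
  adj (A *m B) = adj B *m adj A.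
Proof.
apply/matrixP => i j; rewrite !mxE rmorph_sum; apply: eq_bigr => k _ /=.
by rewrite !mxE rmorphM mulrC.
Qed.

Lemma adjK (R : realType) (m p : nat) (A : 'M[R[i]]_(m, p)) : adj (adj A) = A.
Proof. by apply/matrixP => i j; rewrite !mxE conjcK. Qed.

Lemma adj_fU (R : realType) (n : nat) (t : R) : adj (@fU R n t) = @fU R n (- t).
Proof.
apply/matrixP => i j; rewrite !mxE eq_sym.
case: eqP => [->|_]; last by rewrite !mulr0n conjc0.
by rewrite !mulr1n conjc_expi mulrN.
Qed.

Lemma fU_conjE (R : realType) (n : nat) (t : R) (A : 'M[R[i]]_(n.*2.+1)) j k :
  (@fU R n t *m A *m adj (@fU R n t)) j k = expi ((kk R j - kk R k) * t) * A j k.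
Proof.
rewrite adj_fU /fU mul_mx_diag mul_diag_mx !mxE mulrAC -expiD.
by congr (expi _ * _); ring.
Qed.

Lemma Re_mxtraceM (R : realType) (N : nat) (A B : 'M[R[i]]_N) :
  complex.Re (\tr (A *m B)) = \sum_j \sum_k complex.Re (A j k * B k j).
Proof. by rewrite /mxtrace Re_sum; apply: eq_bigr => j _; rewrite mxE Re_sum. Qed.

(** The form at a vector supported on two basis elements; choices of [x] and [y] give hermitian
    symmetry and the bound on 2x2 minors. *)
Lemma psd_two (R : realType) (N : nat) (A : 'M[R[i]]_N) (i j : 'I_N) (x y : R[i]) :
  psd A -> 0 <= conjc x * x * A i i + conjc x * y * A i j
                + (conjc y * x * A j i + conjc y * y * A j j).
Proof.
move=> /(_ (x *: delta_mx i 0 + y *: delta_mx j 0)).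
have -> : adj (x *: delta_mx i 0 + y *: delta_mx j 0) =
    conjc x *: delta_mx 0 i + conjc y *: delta_mx 0 j :> 'rV[R[i]]_N.
  apply/matrixP => a b; rewrite !mxE !rmorphD !rmorphM /= ord1 eqxx !andbT.
  by rewrite !conjc_nat.
have E (a b : 'I_N) (u v : R[i]) :
    (u *: delta_mx 0 a *m A *m (v *: delta_mx b (0 : 'I_1))) (0 : 'I_1) 0 = u * v * A a b.
  by rewrite -scalemxAr -!scalemxAl -rowE -colE !mxE mulrA [v * u]mulrC.
by rewrite !mulmxDl !mulmxDr ![(_ + _ : 'M[_]_(_, _)) _ _]mxE !E.
Qed.

Lemma psd_diag (R : realType) (N : nat) (A : 'M[R[i]]_N) (i : 'I_N) :
  psd A -> 0 <= A i i.
Proof.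
move=> /(@psd_two _ _ _ i i 1 0).
by rewrite conjc0 conjc1 !mul0r !mulr0 !mul1r mul0r !addr0.
Qed.

Lemma psd_diag_Re (R : realType) (N : nat) (A : 'M[R[i]]_N) (i : 'I_N) :
  psd A -> 0 <= complex.Re (A i i).
Proof. by move=> /psd_diag -/(_ i); rewrite lecE /= => /andP[]. Qed.

Lemma psd_diag_Im (R : realType) (N : nat) (A : 'M[R[i]]_N) (i : 'I_N) :
  psd A -> complex.Im (A i i) = 0.
Proof. by move=> /psd_diag -/(_ i); rewrite lecE /= => /andP[/eqP]. Qed.

(** Nonnegativity in the complex order includes being real, so the weights [(1, 1)] and [(1, i)]
    give the imaginary and the real part of the identity. *)
Lemma psd_herm (R : realType) (N : nat) (A : 'M[R[i]]_N) (i j : 'I_N) :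
  psd A -> A j i = conjc (A i j).
Proof.
move=> Ap; have := psd_two i j 1 1 Ap; have := psd_two i j 1 (Complex 0 1) Ap.
rewrite !lecE /=; have := psd_diag_Im i Ap; have := psd_diag_Im j Ap.
case: (A i i) => a b; case: (A j j) => c d; case: (A i j) => e f.
case: (A j i) => g h /= -> -> /andP[/eqP H _] /andP[/eqP K _].
by apply/eqP; rewrite eq_complex /=; apply/andP; split; apply/eqP; lra.
Qed.

(** A discriminant argument: the weights [- s * A i j] and 1 give a quadratic polynomial in the real
    [s] that is never negative. *)
Lemma psd_sqn_le (R : realType) (N : nat) (A : 'M[R[i]]_N) (i j : 'I_N) :
  psd A -> sqn (A i j) <= complex.Re (A i i) * complex.Re (A j j).
Proof.
move=> Ap; have p0 := psd_diag_Re i Ap; have r0 := psd_diag_Re j Ap.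
have H (s : R) : 0 <= s ^+ 2 * sqn (A i j) * complex.Re (A i i)
    - 2 * s * sqn (A i j) + complex.Re (A j j).
  have := psd_two i j (- (Complex s 0 * A i j)) 1 Ap.
  rewrite (psd_herm i j Ap) lecE /= => /andP[_].
  have := psd_diag_Im i Ap; have := psd_diag_Im j Ap; rewrite /sqn.
  case: (A i i) => a b; case: (A j j) => c d; case: (A i j) => e f /= -> ->.
  by congr (0 <= _); ring.
have z0 : 0 <= sqn (A i j) by rewrite addr_ge0 ?sqr_ge0.
have [p|] := ltrP 0 (complex.Re (A i i)).
  (* This [s] minimizes the quadratic. *)
  have := H (complex.Re (A i i))^-1.
  rewrite -(pmulr_rge0 _ p).
  rewrite [X in 0 <= X](_ : _ = complex.Re (A i i) * complex.Re (A j j) - sqn (A i j)).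
    by rewrite subr_ge0.
  by field; rewrite gt_eqF.
move=> p1; have {p1 p0} pE : complex.Re (A i i) = 0 by apply/eqP; rewrite eq_le p1.
rewrite pE mul0r leNgt; apply/negP => zp.
(* Without a quadratic term, this [s] would give the negative value [- complex.Re (A j j) - 2]. *)
have := H ((complex.Re (A j j) + 1) / sqn (A i j)).
rewrite pE mulr0 add0r -[2 * _ * _]mulrA divfK ?gt_eqF //; lra.
Qed.

Lemma psd_fU_conj (R : realType) (n : nat) (t : R) (A : 'M[R[i]]_(n.*2.+1)) :
  psd A -> psd (@fU R n t *m A *m adj (@fU R n t)).
Proof.
move=> Ap v; have := Ap (adj (@fU R n t) *m v).
by rewrite adjM adjK !mulmxA.
Qed.

Lemma psd_outer (R : realType) (N : nat) (phi : 'cV[R[i]]_N) :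
  psd (phi *m adj phi).
Proof.
move=> v; rewrite mulmxA -mulmxA.
have -> : adj v *m phi = adj (adj phi *m v) by rewrite adjM adjK.
rewrite mxE big_ord1 mxE mulrC; exact: mulcJ_ge0.
Qed.

Lemma state_outer (R : realType) (n : nat) (phi : 'cV[R[i]]_(n.*2.+1)) :
  unit_vec phi -> is_state (phi *m adj phi).
Proof.
move=> u; split; first exact: psd_outer.
have -> : \tr (phi *m adj phi) = \sum_j Complex (sqn (phi j 0)) 0.
  apply: eq_bigr => j _; rewrite mxE big_ord1 mxE.
  case: (phi j 0) => a b; rewrite /sqn /=; apply/eqP; rewrite eq_complex /=.
  by apply/andP; split; apply/eqP; ring.
by rewrite -(raddf_sum (real_complex R)) u.
Qed.

(* Fourier coefficient of [1 - cos] at the frequency [k - j]. *)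
Definition risk_coef (R : realType) (N : nat) (j k : 'I_N) : R :=
  (k == j)%:R - 2^-1 * ((k == j.+1 :> nat)%:R + (j == k.+1 :> nat)%:R).

(** Exchanging the two summations folds the subdiagonal onto the superdiagonal, the shape in which
    the hopping bound is stated. *)
Lemma sum_risk_coef (R : realType) (N : nat) (F : 'I_N -> 'I_N -> R) :
  \sum_j \sum_k risk_coef R j k * F j k =
  \sum_j F j j - 2^-1 * \sum_j \sum_k (F j k + F k j) *+ (k == j.+1 :> nat).
Proof.
have -> : \sum_j \sum_k (F j k + F k j) *+ (k == j.+1 :> nat) =
    \sum_(j < N) \sum_(k < N) ((k == j.+1 :> nat)%:R + (j == k.+1 :> nat)%:R) * F j k.
  under eq_bigr do under eq_bigr do rewrite mulrnDl.
  under eq_bigr do rewrite big_split /=.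
  rewrite big_split /= [X in _ + X]exchange_big -big_split /=; apply: eq_bigr => j _ /=.
  rewrite -big_split; apply: eq_bigr => k _ /=.
  by rewrite mulrDl !mulr_natl.
rewrite mulr_sumr -sumrB; apply: eq_bigr => j _.
rewrite mulr_sumr.
have -> : F j j = \sum_k (k == j)%:R * F j k.
  rewrite (bigD1 j) //= eqxx mul1r big1 ?addr0 // => k /negbTE kj.
  by rewrite kj mul0r.
by rewrite -sumrB; apply: eq_bigr => k _; rewrite /risk_coef mulrBl mulrA.
Qed.

(** The minor bounds for [rho] and [A], with the unit diagonal of [A], bound the real part of
    [rho j k * A k j] by [a j * a k], where [a j] is the square root of [rho j j]. This [a] has norm
    1, so the hopping bound applies to it. *)
Lemma minrisk_le_state (R : realType) (n : nat) (rho A : 'M[R[i]]_(n.*2.+1)) :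
  is_state rho -> psd A -> (forall j, complex.Re (A j j) = 1) ->
  minrisk R n <= \sum_j \sum_k risk_coef R j k * complex.Re (rho j k * A k j).
Proof.
move=> [rp tr1] Ap A1.
pose a j := Num.sqrt (complex.Re (rho j j)).
have aE j : a j ^+ 2 = complex.Re (rho j j) by rewrite sqr_sqrtr // psd_diag_Re.
have sum1 : \sum_j a j ^+ 2 = 1.
  by under eq_bigr do rewrite aE; rewrite -Re_sum [X in complex.Re X]tr1.
have le_a j k : complex.Re (rho j k * A k j) <= a j * a k.
  rewrite (le_trans (Re_le_sqrt_sqn _)) // sqnM -sqrtrM ?psd_diag_Re //.
  rewrite ler_wsqrtr // -[leRHS]mulr1 ler_pM ?addr_ge0 ?sqr_ge0 ?psd_sqn_le //.
  by rewrite (le_trans (psd_sqn_le _ _ Ap)) // !A1 mulr1.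
rewrite sum_risk_coef.
have -> : \sum_j complex.Re (rho j j * A j j) = 1.
  rewrite -sum1; apply: eq_bigr => j _.
  by rewrite complex_ReM A1 aE (psd_diag_Im _ rp) mul0r subr0 mulr1.
have := sine_state_tridiag_le a; rewrite sum1 mulr1 /minrisk => ca.
rewrite lerB // (le_trans _ ca) // mulr_sumr ler_sum // => j _.
rewrite mulr_sumr ler_sum // => k _; case: (k == j.+1 :> nat); last by rewrite !mulr0n mulr0.
rewrite !mulr1n; have := le_a j k; have := le_a k j; lra.
Qed.

(** The real part of [phi_j] times the conjugate of [phi_k] separates real and imaginary parts, so
    the complex hopping form is a sum of two real ones. *)
Lemma unit_vec_risk (R : realType) (n : nat) (phi : 'cV[R[i]]_(n.*2.+1)) :
  unit_vec phi ->
  \sum_j \sum_k risk_coef R j k * complex.Re ((phi *m adj phi) j k) =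
  1 - (\sum_j \sum_k (complex.Re (phi j 0) * complex.Re (phi k 0)) *+ (k == j.+1 :> nat)
     + \sum_j \sum_k (complex.Im (phi j 0) * complex.Im (phi k 0)) *+ (k == j.+1 :> nat)).
Proof.
move=> u; have E j k : complex.Re ((phi *m adj phi) j k) =
    complex.Re (phi j 0) * complex.Re (phi k 0) + complex.Im (phi j 0) * complex.Im (phi k 0).
  by rewrite mxE big_ord1 mxE; case: (phi j 0) => a b; case: (phi k 0) => c d /=; ring.
rewrite sum_risk_coef; congr (_ - _).
  by rewrite -[RHS]u; apply: eq_bigr => j _; rewrite E -!expr2.
rewrite mulr_sumr -big_split; apply: eq_bigr => j _.
rewrite mulr_sumr -big_split; apply: eq_bigr => k _ /=.
rewrite !E -mulrnDl mulrnAr; congr (_ *+ _).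
by field.
Qed.

Lemma unit_vec_Re_Im (R : realType) (N : nat) (phi : 'cV[R[i]]_N) : unit_vec phi ->
  \sum_j complex.Re (phi j 0) ^+ 2 + \sum_j complex.Im (phi j 0) ^+ 2 = 1.
Proof. by move=> <-; rewrite -big_split. Qed.

Lemma unit_vec_risk_ge (R : realType) (n : nat) (phi : 'cV[R[i]]_(n.*2.+1)) :
  unit_vec phi ->
  minrisk R n <= \sum_j \sum_k risk_coef R j k * complex.Re ((phi *m adj phi) j k).
Proof.
move=> u; rewrite unit_vec_risk // lerB // -[cos _]mulr1.
rewrite -[X in _ <= _ * X](unit_vec_Re_Im u) mulrDr lerD //.
  exact: (sine_state_tridiag_le (fun j => complex.Re (phi j 0))).
exact: (sine_state_tridiag_le (fun j => complex.Im (phi j 0))).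
Qed.

(** If the sum of the two real hopping bounds is tight, so is each of them. The resulting real
    factors for the real and imaginary parts of [phi] combine into one complex [C]. *)
Lemma unit_vec_risk_eq (R : realType) (n : nat) (phi : 'cV[R[i]]_(n.*2.+1)) :
  unit_vec phi ->
  (\sum_j \sum_k risk_coef R j k * complex.Re ((phi *m adj phi) j k) = minrisk R n <->
   exists C : R[i], forall j, phi j 0 = C * Complex (sine_state R j) 0).
Proof.
move=> u; rewrite unit_vec_risk //.
pose x j := complex.Re (phi j 0); pose y j := complex.Im (phi j 0).
have lx := sine_state_tridiag_le x; have ly := sine_state_tridiag_le y.
have e1 : cos (pi / (n.*2.+2)%:R) * (\sum_j x j ^+ 2) +
    cos (pi / (n.*2.+2)%:R) * (\sum_j y j ^+ 2) = cos (pi / (n.*2.+2)%:R).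
  by rewrite -mulrDr unit_vec_Re_Im // mulr1.
split=> [e|[C pE]].
  have [|Cx xE] := (sine_state_tridiag_eq x).1.
    by apply/eqP; rewrite eq_le lx /=; move: e lx ly e1; rewrite /minrisk -/x -/y /x /y; lra.
  have [|Cy yE] := (sine_state_tridiag_eq y).1.
    by apply/eqP; rewrite eq_le ly /=; move: e lx ly e1; rewrite /minrisk -/x -/y /x /y; lra.
  exists (Complex Cx Cy) => j; move: (xE j) (yE j); rewrite /x /y.
  case: (phi j 0) => a b /= -> ->; apply/eqP; rewrite eq_complex /=.
  by rewrite !mulr0 subr0 add0r !eqxx.
have xe := (sine_state_tridiag_eq x).2; have ye := (sine_state_tridiag_eq y).2.
rewrite /minrisk -e1 xe ?ye //.
  exists (complex.Im C) => j; rewrite /y pE.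
  by case: (C) => a b /=; rewrite mulr0 add0r.
exists (complex.Re C) => j; rewrite /x pE.
by case: (C) => a b /=; rewrite mulr0 subr0.
Qed.

(** * The lower bound for covariant measurements *)

Lemma Omega_itv (R : realType) : @Omega R = `]- pi, pi]%classic.
Proof. by apply/seteqP; split => x /=; rewrite in_itv. Qed.

Lemma measurable_Omega (R : realType) : measurable (@Omega R).
Proof. rewrite Omega_itv; exact: measurable_itv. Qed.

(** Two points of the half-open interval differ by less than a full turn, so representatives modulo
    [2 * pi] are unique. *)
Lemma Omega_shift_eq (R : realType) (x y : R) (k : int) :
  Omega x -> Omega y -> x = y + k%:~R * (2 * pi) -> k = 0.
Proof.
move=> /andP[x1 x2] /andP[y1 y2] e; have p0 := pi_gt0 R.
have : `|k%:~R : R| < 1.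
  rewrite -(ltr_pM2r (x := 2 * pi)) ?mulr_gt0 //.
  rewrite -[X in _ * X]gtr0_norm ?mulr_gt0 // -normrM.
  have -> : k%:~R * (2 * pi) = x - y by rewrite e; ring.
  by rewrite ltr_norml; apply/andP; split; lra.
by rewrite -intr_norm -[1]/(1%:~R) ltr_int; lia.
Qed.

Lemma shift_itv (R : realType) (h t : R) : - pi <= t - h -> t <= pi -> 0 < h ->
  Defs.shift `]- h, 0%R]%classic t = `]t - h, t]%classic.
Proof.
move=> th tp h0; apply/seteqP; split => x /=; rewrite /Defs.shift /= !in_itv /=.
  move=> [xO [b [k [+ e]]]]; rewrite in_itv /= => /andP[b1 b2].
  have k0 : k = 0.
    by apply: (Omega_shift_eq xO _ e); apply/andP; split; lra.
  by rewrite e k0 mul0r addr0; apply/andP; split; lra.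
move=> /andP[x1 x2]; split; first by apply/andP; split; lra.
exists (x - t), 0; rewrite in_itv /= mul0r; split; last by ring.
by apply/andP; split; lra.
Qed.

Lemma expiDint (R : realType) (x : R) (k : int) :
  expi (x + k%:~R * (2 * pi)) = expi x.
Proof.
have E (y : R) : expi (y + 2 * pi) = expi y.
  by rewrite mulr_natl /expi cosD2pi sinD2pi.
have N (m : nat) (y : R) : expi (y + m%:R * (2 * pi)) = expi y.
  elim: m => [|m IH]; first by rewrite mul0r addr0.
  by rewrite -natr1 mulrDl mul1r addrA E IH.
case: (intP k) => [|m|m]; first by rewrite mul0r addr0.
  exact: N.
rewrite -[LHS](N m.+1); congr expi.
by rewrite mulrNz mulNr addrNK.
Qed.

Lemma cos_lt1 (R : realType) (x : R) : 0 < x < 2 * pi -> cos x < 1.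
Proof.
move=> /andP[x0 x2].
have -> : x = (x / 2) *+ 2 by rewrite -mulr_natr divfK.
have : 0 < sin (x / 2) by apply: sin_gt0_pi; apply/andP; split; lra.
rewrite cos_mulr2n cos2sin2 => s0; have := exprn_gt0 2 s0; lra.
Qed.

Lemma expi_int_neq1 (R : realType) (d : int) (q : nat) : d != 0 -> (`|d| < q)%N ->
  expi (d%:~R * (2 * pi / q%:R) : R) != 1.
Proof.
move=> d0 dq; rewrite eq_complex /= negb_and; apply/orP; left.
rewrite lt_eqF // -cos_norm; apply: cos_lt1.
have q0 : 0 < q%:R :> R by rewrite ltr0n; lia.
have h0 : 0 < 2 * pi / q%:R :> R by rewrite divr_gt0 ?mulr_gt0 ?pi_gt0.
rewrite normr_gt0 mulf_neq0 ?intr_eq0 ?(gt_eqF h0) //=.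
rewrite normrM (gtr0_norm h0).
rewrite mulrCA gtr_pMr ?mulr_gt0 ?pi_gt0 // ltr_pdivrMr // mul1r.
by rewrite -intr_norm -natr_absz ltr_nat.
Qed.

(* The right ends of [q] consecutive arcs of length [2 pi / q] tiling (-pi, pi]. *)
Definition arc_end (R : realType) (q i : nat) : R := - pi + (i.+1)%:R * (2 * pi / q%:R).

(** A geometric sum: multiplied by its ratio minus 1 it telescopes to zero, and the bound on [d]
    keeps the ratio away from 1 unless [d = 0]. *)
Lemma sum_expi_arc_end (R : realType) (q : nat) (d : int) : (`|d| < q)%N ->
  \sum_(i < q) expi (d%:~R * arc_end R q i) = q%:R *+ (d == 0).
Proof.
move=> dq; case: eqP => [->|/eqP d0].
  under eq_bigr do rewrite mul0r expi0.
  by rewrite sumr_const card_ord mulr1n.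
have e1 := @expi_int_neq1 R d q d0 dq; rewrite mulr0n.
have q0 : q%:R != 0 :> R by rewrite pnatr_eq0; lia.
pose G i := expi (d%:~R * arc_end R q i).
have GS i : G i.+1 = G i * expi (d%:~R * (2 * pi / q%:R)).
  by rewrite /G -expiD -mulrDr /arc_end -[i.+2%:R]natr1 mulrDl mul1r addrA.
have : (\sum_(i < q) G i) * (expi (d%:~R * (2 * pi / q%:R)) - 1) = 0.
  rewrite mulr_suml; under eq_bigr do rewrite mulrBr mulr1 -GS.
  rewrite -(big_mkord xpredT (fun i => G i.+1 - G i)) telescope_sumr //.
  (* The two ends of the telescope differ by [d] full turns. *)
  apply/eqP; rewrite subr_eq0; apply/eqP.
  rewrite /G -[RHS](expiDint _ d); congr expi; rewrite /arc_end -natr1 mul1r.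
  by field.
by move/eqP; rewrite mulf_eq0 subr_eq0 (negbTE e1) orbF => /eqP.
Qed.

(** Product-to-sum: the factor [1 - cos y] couples the frequency [d] only to [d + 1] and [d - 1],
    whence a tridiagonal risk form. *)
Lemma riskM_expi (R : realType) (z : R[i]) (d : int) (y : R) :
  (1 - cos y) * complex.Re (z * expi (d%:~R * y)) =
  complex.Re (z * expi (d%:~R * y)) - 2^-1 *
   (complex.Re (z * expi ((d + 1)%:~R * y)) + complex.Re (z * expi ((d - 1)%:~R * y))).
Proof.
have -> : (d + 1)%:~R * y = d%:~R * y + y by rewrite intrD mulrDl mul1r.
have -> : (d - 1)%:~R * y = d%:~R * y + - y by rewrite intrD mulrDl mulN1r.
rewrite !expiD /expi cosN sinN.
by case: z => a b /=; field.
Qed.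

Lemma kkB (R : realType) (n : nat) (j k : 'I_(n.*2.+1)) :
  kk R k - kk R j = ((k : int) - (j : int))%:~R.
Proof. by rewrite /kk intrD intrN -!pmulrn; ring. Qed.

Lemma risk_coefE (R : realType) (N : nat) (j k : 'I_N) :
  let d := (k : int) - (j : int) in
  risk_coef R j k = (d == 0)%:R - 2^-1 * ((d + 1 == 0)%:R + (d - 1 == 0)%:R).
Proof.
rewrite /= /risk_coef; congr (_%:R - _ * _).
  by rewrite subr_eq0.
have -> : ((k : int) - (j : int) + 1 == 0) = (j == k.+1 :> nat).
  by apply/idP/idP => /eqP e; apply/eqP; lia.
have -> : ((k : int) - (j : int) - 1 == 0) = (k == j.+1 :> nat).
  by apply/idP/idP => /eqP e; apply/eqP; lia.
by rewrite addrC.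
Qed.

Lemma sum_risk_arc_end (R : realType) (n q : nat) (z : R[i]) (j k : 'I_(n.*2.+1)) :
  (n.*2.+1 < q)%N ->
  \sum_(i < q) (1 - cos (arc_end R q i)) *
     complex.Re (z * expi ((kk R k - kk R j) * arc_end R q i)) =
  q%:R * (risk_coef R j k * complex.Re z).
Proof.
move=> nq; rewrite risk_coefE kkB; set d := (_ - _ : int).
have dn : (`|d| <= n.*2)%N by have := ltn_ord j; have := ltn_ord k; rewrite /d; lia.
have S (e : int) : (`|e| < q)%N ->
    \sum_(i < q) complex.Re (z * expi (e%:~R * arc_end R q i)) =
    q%:R * ((e == 0)%:R * complex.Re z).
  move=> eq; rewrite -Re_sum -mulr_sumr sum_expi_arc_end //.
  case: (e == 0); last by rewrite mulr0n mulr0 mul0r mulr0.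
  rewrite mulr1n mul1r complex_ReM.
  by rewrite -[q%:R]conjc_nat -(rmorph_nat (real_complex R)) /= mulrC oppr0 mulr0 subr0.
under eq_bigr do rewrite riskM_expi.
(* All three frequencies are at most [2n+1 < q] in absolute value, so the [q] sample points alias no
   nonzero one to 0. *)
rewrite sumrB -mulr_sumr big_split /= !S; [|lia..].
ring.
Qed.

Lemma bigsetU_arcs (R : realType) (a h : R) (q : nat) : 0 <= h ->
  \big[setU/set0]_(i < q) `](a + i%:R * h), (a + (i.+1)%:R * h)]%classic =
  `]a, a + q%:R * h]%classic.
Proof.
move=> h0; elim: q => [|q IH].
  by rewrite big_ord0 mul0r addr0 set_itvoc0.
rewrite big_ord_recr /= IH; apply/seteqP; split => x /=; rewrite !in_itv /=.
  have : 0 <= q%:R * h by rewrite mulr_ge0.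
  by move=> qh; rewrite -natr1 mulrDl mul1r => -[] /andP[? ?]; apply/andP; split; lra.
move=> /andP[x1 x2]; case: (lerP x (a + q%:R * h)) => xq; [left|right].
  by rewrite x1.
by rewrite x2.
Qed.

Lemma trivIset_arcs (R : realType) (a h : R) : 0 <= h ->
  trivIset setT (fun i : nat => `](a + i%:R * h), (a + (i.+1)%:R * h)]%classic).
Proof.
move=> h0; apply/trivIsetP => i j _ _; wlog ij : i j / (i < j)%N.
  move=> W; rewrite neq_ltn => /orP[] ij; first by apply: W => //; rewrite ltn_eqF.
  by rewrite setIC; apply: W => //; rewrite ltn_eqF.
move=> _; apply/seteqP; split => x //= [].
rewrite !in_itv /= => /andP[_ x1] /andP[x2 _].
have := lt_le_trans x2 x1; rewrite ltrD2l ltNge => /negP; apply.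
by rewrite ler_wpM2r // ler_nat.
Qed.

Lemma cos_lip (R : realType) (x y : R) : x <= y -> cos x <= cos y + (y - x).
Proof.
move=> xy; have [|c _] := @MVT_segment R cos (fun x => - sin x) x y xy.
  by apply: continuous_subspaceT => z; exact: continuous_cos.
have : `|sin c * (y - x)| <= y - x.
  by rewrite normrM (ger0_norm (x := y - x)) ?subr_ge0 // ler_piMl ?subr_ge0 ?sin_max.
by rewrite ler_norml mulNr => /andP[? ?] ?; lra.
Qed.

Lemma outcome_measure_Omega (R : realType) (N : nat) (sigma : 'M[R[i]]_N)
    (M : set R -> 'M[R[i]]_N) (mu : {measure set R -> \bar R}) :
  M (@Omega R) = 1%:M -> outcome_measure sigma M mu ->
  mu (@Omega R) = (complex.Re (\tr sigma))%:E.
Proof.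
by move=> M1 /(_ _ (@measurable_Omega R)) ->; rewrite setIid M1 mulmx1.
Qed.

Lemma measurable_risk (R : realType) (D : set R) (t : R) :
  measurable_fun D (fun x : R => (1 - cos (x - t))%:E).
Proof.
apply/measurable_EFinP/measurable_funTS/measurable_funB => //.
apply: continuous_measurable_fun => x.
apply: (@continuous_comp _ _ _ (fun x => x - t) cos); last exact: continuous_cos.
by apply: cvgB; [exact: cvg_id|exact: cvg_cst].
Qed.

(** By the Lipschitz bound, the risk at the right end of an arc exceeds the risk anywhere on it by
    at most the arc length [h]; total mass 1 turns this pointwise error into [h]. *)
Lemma risk_integral_ge_arcs (R : realType) (mu : {measure set R -> \bar R}) (q : nat) :
  (0 < q)%N -> mu (@Omega R) = 1%E ->
  (\sum_(i < q) (1 - cos (arc_end R q i))%:E *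
       mu `](arc_end R q i - 2 * pi / q%:R)%R, (arc_end R q i)]%classic
   <= \int[mu]_(x in @Omega R) (1 - cos (x - 0))%:E + (2 * pi / q%:R)%:E)%E.
Proof.
move=> q0 mu1; set h := 2 * pi / q%:R.
have h0 : 0 <= h by rewrite divr_ge0 ?mulr_ge0 ?pi_ge0.
have hq : q%:R * h = 2 * pi by rewrite mulrC divfK // pnatr_eq0 -lt0n.
pose B i := `](- pi + i%:R * h), (- pi + (i.+1)%:R * h)]%classic : set R.
have BE i : `](arc_end R q i - h), (arc_end R q i)]%classic = B i.
  by rewrite /B /arc_end -/h -natr1 mulrDl mul1r addrA addrK.
have mB i : measurable (B i) by exact: measurable_itv.
have iotaE : iota 0 q = index_iota 0 q by rewrite /index_iota subn0.
have UB : @Omega R = \big[setU/set0]_(i <- iota 0 q) B i.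
  rewrite iotaE big_mkord (@bigsetU_arcs _ _ _ q h0) hq Omega_itv.
  by rewrite mulrDl mul1r addKr.
have f0 (x : R) : 0 <= 1 - cos (x - 0) by rewrite subr_ge0 cos_le1.
have -> : (\int[mu]_(x in @Omega R) (1 - cos (x - 0))%:E + h%:E =
    \int[mu]_(x in @Omega R) ((1 - cos (x - 0))%:E + h%:E))%E.
  rewrite ge0_integralD; [|exact: measurable_Omega
    |by move=> x _; rewrite lee_fin|exact: measurable_risk
    |by move=> x _; rewrite lee_fin|exact: measurable_cst].
  by rewrite integral_cst ?mu1 ?mule1 //; exact: measurable_Omega.
have mf D : measurable_fun D (fun x : R => ((1 - cos (x - 0))%:E + h%:E)%E).
  by apply: emeasurable_funD => //; exact: measurable_risk.
rewrite {1}UB ge0_integral_bigsetU ?iota_uniq //; last 2 first.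
- by apply: sub_trivIset (@trivIset_arcs R (- pi) h h0).
- by move=> x _; rewrite -EFinD lee_fin addr_ge0.
rewrite iotaE big_mkord; apply: lee_sum => i _.
rewrite BE -integral_cst //; apply: ge0_le_integral => //=.
move=> x; rewrite /B /= in_itv /= => /andP[x1 x2]; rewrite -EFinD lee_fin subr0.
have := cos_lip x2; rewrite /arc_end -/h.
move: x1 x2; rewrite -natr1 mulrDl mul1r; lra.
Qed.

Lemma arc_end_Omega (R : realType) (q i : nat) : (i < q)%N ->
  - pi <= arc_end R q i - 2 * pi / q%:R /\ arc_end R q i <= pi.
Proof.
move=> iq; have q0 : 0 < q%:R :> R by rewrite ltr0n; lia.
have h0 : 0 < 2 * pi / q%:R :> R by rewrite divr_gt0 ?mulr_gt0 ?pi_gt0.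
have hq : q%:R * (2 * pi / q%:R) = 2 * pi :> R by rewrite mulrC divfK // gt_eqF.
rewrite /arc_end; split.
  rewrite -natr1 mulrDl mul1r addrA addrK lerDl mulr_ge0 // ltW //.
have : (i.+1)%:R * (2 * pi / q%:R) <= q%:R * (2 * pi / q%:R) :> R.
  by rewrite ler_pM2r // ler_nat.
by rewrite hq; lra.
Qed.

(** Each arc is the translate, by its right end, of the arc of the same length ending at 0; [1 < q]
    makes the latter at most [pi] long, hence a subset of [Omega]. *)
Lemma covariant_arc (R : realType) (n q i : nat) (M : set R -> 'M[R[i]]_(n.*2.+1)) :
  covariant M -> (1 < q)%N -> (i < q)%N ->
  M `](arc_end R q i - 2 * pi / q%:R), (arc_end R q i)]%classic =
  @fU R n (arc_end R q i) *m M `]- (2 * pi / q%:R), 0%R]%classic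
    *m adj (@fU R n (arc_end R q i)).
Proof.
move=> [_ cov] q1 iq; have [a1 a2] := @arc_end_Omega R q i iq.
have q0 : 0 < q%:R :> R by rewrite ltr0n; lia.
have h0 : 0 < 2 * pi / q%:R :> R by rewrite divr_gt0 ?mulr_gt0 ?pi_gt0.
have h1 : 2 * pi / q%:R <= pi :> R.
  by rewrite ler_pdivrMr // mulrC ler_pM2l ?pi_gt0 // ler_nat.
rewrite cov ?shift_itv //; first by apply/andP; split => //; lra.
move=> x; rewrite Omega_itv /= !in_itv /= => /andP[x1 x2]; apply/andP; split.
  lra.
have := pi_gt0 R; lra.
Qed.

Lemma covariant_arc_psd (R : realType) (n q : nat) (M : set R -> 'M[R[i]]_(n.*2.+1)) :
  covariant M -> (1 < q)%N -> psd (M `]- (2 * pi / q%:R), 0%R]%classic).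
Proof.
move=> [[Mp _ _] _] q1; apply: Mp => //.
have q0 : 0 < q%:R :> R by rewrite ltr0n; lia.
have h1 : 2 * pi / q%:R <= pi :> R.
  by rewrite ler_pdivrMr // mulrC ler_pM2l ?pi_gt0 // ler_nat.
move=> x; rewrite Omega_itv /= !in_itv /= => /andP[x1 x2]; apply/andP; split.
  lra.
have := pi_gt0 R; lra.
Qed.

Lemma arc_subset_Omega (R : realType) (q i : nat) : (i < q)%N ->
  `](arc_end R q i - 2 * pi / q%:R), (arc_end R q i)]%classic `<=` @Omega R.
Proof.
move=> /(@arc_end_Omega R) [a1 a2] x; rewrite Omega_itv /= !in_itv /= => /andP[x1 x2].
by apply/andP; split; lra.
Qed.

(* By covariance all arcs carry the same diagonal, and they tile the circle. *)
Lemma covariant_arc_diag (R : realType) (n q : nat) (M : set R -> 'M[R[i]]_(n.*2.+1)) j :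
  covariant M -> (1 < q)%N ->
  q%:R * complex.Re (M `]- (2 * pi / q%:R), 0%R]%classic j j) = 1.
Proof.
move=> cM q1; set A := M _.
have [[_ M1 Mm] _] := cM.
(* The trace against the basis state at [j] reads off the diagonal entry [M B j j], which is
   therefore additive in [B]. *)
have [mu muM] := Mm (delta_mx j 0 *m adj (delta_mx j 0)) (@psd_outer _ _ _).
have E (B : 'M[R[i]]_(n.*2.+1)) :
    \tr (delta_mx j 0 *m adj (delta_mx j (0 : 'I_1)) *m B) = B j j.
  have -> : adj (delta_mx j 0) = delta_mx 0 j :> 'rV[R[i]]_(n.*2.+1).
    by apply/matrixP => a b; rewrite !mxE conjc_nat andbC.
  by rewrite -mulmxA mxtrace_mulC /mxtrace big_ord1 -rowE -colE !mxE.
have h0 : 0 <= 2 * pi / q%:R :> R by rewrite divr_ge0 ?mulr_ge0 ?pi_ge0.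
have hq : q%:R * (2 * pi / q%:R) = 2 * pi :> R.
  by rewrite mulrC divfK // pnatr_eq0 -lt0n ltnW.
pose B i : set R :=
  `](- pi + i%:R * (2 * pi / q%:R)), (- pi + (i.+1)%:R * (2 * pi / q%:R))]%classic.
have BE i : B i = `](arc_end R q i - 2 * pi / q%:R), (arc_end R q i)]%classic.
  by apply/esym; rewrite /B /arc_end -natr1 mulrDl mul1r addrA addrK.
have muO : mu (@Omega R) = 1%E.
  by rewrite (outcome_measure_Omega M1 muM) -[_ *m _]mulmx1 E mxE eqxx.
have UB : @Omega R = \big[setU/set0]_(i < q) B i.
  rewrite (@bigsetU_arcs _ _ _ q h0) hq Omega_itv.
  by rewrite mulrDl mul1r addKr.
move: muO; rewrite UB measure_bigsetU; last 2 first.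
- by move=> i; exact: measurable_itv.
- exact: trivIset_arcs.
rewrite (eq_bigr (fun=> (complex.Re (A j j))%:E)).
  by rewrite sumEFin sumr_const card_ord mulr_natl; case.
move=> i _; have mB : measurable (B i) by exact: measurable_itv.
transitivity (complex.Re
    (\tr (delta_mx j 0 *m adj (delta_mx j (0 : 'I_1)) *m M (B i `&` @Omega R))))%:E.
  exact: muM.
rewrite setIidl; last by rewrite BE; exact: arc_subset_Omega.
by rewrite E BE (covariant_arc cM) // fU_conjE subrr mul0r expi0 mul1r.
Qed.

Lemma fU0_conj (R : realType) (n : nat) (A : 'M[R[i]]_(n.*2.+1)) :
  @fU R n 0 *m A *m adj (@fU R n 0) = A.
Proof. by apply/matrixP => j k; rewrite fU_conjE mulr0 expi0 mul1r. Qed.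

Lemma minrisk_le_arcs (R : realType) (n q : nat) (rho : 'M[R[i]]_(n.*2.+1))
    (M : set R -> 'M[R[i]]_(n.*2.+1)) (mu : {measure set R -> \bar R}) :
  is_state rho -> covariant M -> outcome_measure rho M mu -> (n.*2.+1 < q)%N ->
  ((minrisk R n)%:E <=
   \int[mu]_(x in @Omega R) (1 - cos (x - 0))%:E + (2 * pi / q%:R)%:E)%E.
Proof.
move=> rs cM muM nq; have q1 : (1 < q)%N by lia.
have [_ tr1] := rs; have [[_ M1 _] _] := cM.
have mu1 : mu (@Omega R) = 1%E by rewrite (outcome_measure_Omega M1 muM) tr1.
apply: le_trans (risk_integral_ge_arcs (ltnW q1) mu1).
pose A := q%:R *: M `]- (2 * pi / q%:R), 0%R]%classic.
have qC : q%:R = Complex q%:R 0 :> R[i] by rewrite -(rmorph_nat (real_complex R)).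
have Ap : psd A.
  move=> v; rewrite /A -scalemxAr -scalemxAl mxE mulr_ge0 ?ler0n //.
  exact: (covariant_arc_psd cM).
have A1 j : complex.Re (A j j) = 1.
  by rewrite mxE complex_ReM qC /= mul0r subr0 (covariant_arc_diag _ cM).
have := minrisk_le_state rs Ap A1; rewrite -lee_fin => /le_trans; apply.
(* By covariance the [i]-th arc contributes the entries of the reference arc times characters at its
   right end; exchanging the sums then leaves one sampled character sum per pair [j, k]. *)
rewrite (eq_bigr (fun i : 'I_q => ((1 - cos (arc_end R q i)) *
    \sum_j \sum_k complex.Re (rho j k * M `]- (2 * pi / q%:R), 0%R]%classic k j *
      expi ((kk R k - kk R j) * arc_end R q i)))%:E)); last first.
  move=> i _; rewrite muM; last exact: measurable_itv.
  rewrite setIidl ?(covariant_arc cM) //; last exact: arc_subset_Omega.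
  rewrite -EFinM Re_mxtraceM; congr (_ * _)%:E.
  apply: eq_bigr => j _; apply: eq_bigr => k _.
  by rewrite fU_conjE; congr complex.Re; ring.
rewrite sumEFin lee_fin le_eqVlt; apply/orP; left; apply/eqP.
under [RHS]eq_bigr do rewrite mulr_sumr.
rewrite [RHS]exchange_big; apply: eq_bigr => j _ /=.
under [RHS]eq_bigr do rewrite mulr_sumr.
rewrite [RHS]exchange_big; apply: eq_bigr => k _ /=.
rewrite sum_risk_arc_end // mulrCA; congr (_ * _).
by rewrite mxE mulrCA complex_ReM qC /= mul0r subr0.
Qed.

(** The supremum dominates its value at parameter 0, where the arc bound holds with an error that
    tends to 0 with [1 / q]. *)
Lemma DR_ge (R : realType) (n : nat) (rho : 'M[R[i]]_(n.*2.+1))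
    (M : set R -> 'M[R[i]]_(n.*2.+1)) :
  is_state rho -> covariant M -> ((minrisk R n)%:E <= DR rho M)%E.
Proof.
move=> rs cM; have [[_ _ Mm] _] := cM; have [mu muM] := Mm rho rs.1.
apply: (@le_trans _ _ (\int[mu]_(x in @Omega R) (1 - cos (x - 0))%:E)%E); last first.
  apply: ereal_sup_ubound; exists 0, mu; split => //.
    by apply/andP; split; have := pi_gt0 R; lra.
  by rewrite fU0_conj.
apply/lee_addgt0Pr => e e0.
(* The first summand makes [2 * pi / q] at most [e], the second ensures [2n+1 < q]. *)
pose q := (Num.bound (2 * pi / e) + n.*2.+2)%N.
have nq : (n.*2.+1 < q)%N by rewrite /q; lia.
move: nq => /(minrisk_le_arcs rs cM muM) /le_trans; apply.
apply: leeD2l; rewrite lee_fin.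
have q0 : 0 < q%:R :> R by rewrite ltr0n /q; lia.
rewrite ler_pdivrMr // [e * _]mulrC -ler_pdivrMr //.
have : 0 <= 2 * pi / e by rewrite divr_ge0 ?mulr_ge0 ?pi_ge0 // ltW.
move=> /archi_boundP /ltW /le_trans; apply.
by rewrite ler_nat; lia.
Qed.

(** * Translation-invariant integrals of trigonometric functions *)

Lemma lebesgue_translate (R : realType) (s : R) (A : set R) : measurable A ->
  pushforward lebesgue_measure (fun x : measurableTypeR R => x + s : measurableTypeR R) A
  = lebesgue_measure A.
Proof.
move=> mA; have mf : measurable_fun setT (fun x : measurableTypeR R => x + s : measurableTypeR R).
  exact: measurable_funD.
apply/esym; apply: lebesgue_measure_unique => // _ [[a b]] _ <-.
rewrite /pushforward [X in _ = lebesgue_measure X](_ : _ = `]a - s, b - s]%classic); last first.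
  by apply/seteqP; split => x /=; rewrite !in_itv /= ltrBlDr lerBrDr.
rewrite !lebesgue_measure_itv /= !lte_fin ltrD2r.
by case: ifP => // _; rewrite -!EFinB; congr _%:E; ring.
Qed.

(* The window [-3 pi, 3 pi] contains all translates of (-pi, pi] that are needed. *)
Lemma bounded_integrable (R : realType) (A : set R) (f : R -> R) (K : R) :
  measurable A -> A `<=` `[- (3 * pi), 3 * pi]%classic ->
  measurable_fun setT f -> (forall x, `|f x| <= K) ->
  (@lebesgue_measure R).-integrable A (EFin \o f).
Proof.
move=> mA; set I := (X in A `<=` X) => AO mf fK; apply: measurable_bounded_integrable => //.
- have : (lebesgue_measure A <= lebesgue_measure I)%E.
    by apply: le_measure => //; rewrite inE //; exact: measurable_itv.
  move=> /le_lt_trans; apply.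
  by rewrite lebesgue_measure_itv /=; case: ifP => // _; rewrite -EFinB ltry.
- exact: measurable_funS mf.
exists K; split; first exact: num_real.
by move=> M KM x _ /=; rewrite (le_trans (fK x)) // ltW.
Qed.

Lemma Rintegral_translate (R : realType) (s : R) (A B : set R) (f : R -> R) (K : R) :
  measurable A -> (forall x, B x <-> A (x + s)) ->
  A `<=` `[- (3 * pi), 3 * pi]%classic -> B `<=` `[- (3 * pi), 3 * pi]%classic ->
  measurable_fun setT f -> (forall x, `|f x| <= K) ->
  Rintegral lebesgue_measure A f = Rintegral lebesgue_measure B (fun x => f (x + s)).
Proof.
move=> mA AB A3 B3 mf fK; rewrite /Rintegral; congr fine.
pose phi : measurableTypeR R -> measurableTypeR R := fun x => x + s.
have mphi : measurable_fun setT phi by exact: measurable_funD.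
have BE : phi @^-1` A = B by apply/seteqP; split => x /AB.
have mB : measurable B by rewrite -BE -[X in measurable X]setTI; exact: mphi.
transitivity (\int[pushforward lebesgue_measure phi]_(y in A) (f y)%:E)%E.
  by apply: eq_measure_integral => C mC _; apply/esym; exact: lebesgue_translate.
rewrite integral_pushforward //.
- by rewrite BE.
- exact/measurable_EFinP.
rewrite BE; apply: (@bounded_integrable _ _ (fun x => f (x + s)) K) => //.
exact: (measurableT_comp mf mphi).
Qed.

(** The translated window overhangs by []pi, pi + t]], which one period carries onto the missing
    piece []- pi, - pi + t]]. A negative [t] is first replaced by [t + 2 * pi], still within the
    bounds. *)
Lemma Rintegral_periodic_translate (R : realType) (t : R) (f : R -> R) (K : R) :
  - (2 * pi) <= t -> t <= 2 * pi -> measurable_fun setT f -> (forall x, `|f x| <= K) ->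
  (forall x, f (x + 2 * pi) = f x) ->
  Rintegral lebesgue_measure (@Omega R) (fun x => f (x + t)) =
  Rintegral lebesgue_measure (@Omega R) f.
Proof.
have p0 := pi_gt0 R; move=> tN tP mf fK fp.
wlog t0 : t tN tP / 0 <= t.
  move=> W; have [t0|t0] := leP 0 t; first exact: W.
  rewrite -(W (t + 2 * pi)); [|lra..].
  by congr Rintegral; apply/funext => x; rewrite addrA fp.
have sub a b : - (3 * pi) <= a -> b <= 3 * pi ->
    `]a, b]%classic `<=` `[- (3 * pi), 3 * pi]%classic.
  by move=> a3 b3 x /=; rewrite !in_itv /= => /andP[? ?]; apply/andP; split; lra.
have split (a b c : R) : - (3 * pi) <= a -> a <= b -> b <= c -> c <= 3 * pi ->
    Rintegral lebesgue_measure `]a, c]%classic f =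
    Rintegral lebesgue_measure `]a, b]%classic f + Rintegral lebesgue_measure `]b, c]%classic f.
  move=> a3 ab bc c3; rewrite -Rintegral_setU //=; last 2 first.
  - apply: (@bounded_integrable _ _ f K) => //; first exact: measurableU.
    by rewrite subUset; split; apply: sub; lra.
  - apply/disj_setPS => x /= []; rewrite !in_itv /= => /andP[_ ?] /andP[? _]; lra.
  congr Rintegral; apply/seteqP; split => x /=; rewrite !in_itv /=.
    move=> /andP[x1 x2]; case: (lerP x b) => xb; [left|right].
      by rewrite x1.
    by rewrite x2.
  by case=> /andP[x1 x2]; apply/andP; split; lra.
rewrite Omega_itv -(@Rintegral_translate _ t `](- pi + t), (pi + t)]%classic _ f K) //.
- rewrite (split _ pi); [|lra..]; rewrite [RHS](split _ (- pi + t)); [|lra..].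
  rewrite addrC; congr (_ + _).
  rewrite (@Rintegral_translate _ (2 * pi) _ `](- pi), (- pi + t)]%classic f K) //.
  + by congr Rintegral; apply/funext => x.
  + by move=> x /=; rewrite !in_itv /=; split => /andP[? ?]; apply/andP; split; lra.
  + by apply: sub; lra.
  + by apply: sub; lra.
- by move=> x /=; rewrite !in_itv /=; split => /andP[? ?]; apply/andP; split; lra.
- by apply: sub; lra.
- by apply: sub; lra.
Qed.

Lemma measurable_linear (R : realType) (r c : R) :
  measurable_fun setT (fun x : R => r * x + c).
Proof. by apply: measurable_funD => //; exact: measurable_funM. Qed.

Lemma measurable_Re_expi (R : realType) (z : R[i]) (r c : R) :
  measurable_fun setT (fun x : R => complex.Re (z * expi (r * x + c))).
Proof.
under eq_fun do rewrite complex_ReM /=.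
by apply: measurable_funB; apply: measurable_funM => //;
  apply: measurableT_comp (measurable_linear r c); apply: continuous_measurable_fun;
  [exact: continuous_cos|exact: continuous_sin].
Qed.

Lemma Re_expi_bound (R : realType) (z : R[i]) (y : R) :
  `|complex.Re (z * expi y)| <= `|complex.Re z| + `|complex.Im z|.
Proof.
rewrite complex_ReM /= (le_trans (ler_normB _ _)) // !normrM lerD // ler_piMr //.
  exact: cos_max.
exact: sin_max.
Qed.

Lemma Omega_sub3 (R : realType) (A : set R) :
  A `<=` @Omega R -> A `<=` `[- (3 * pi), 3 * pi]%classic.
Proof.
move=> AO x /AO /andP[x1 x2]; rewrite /= in_itv /=; have := pi_gt0 R.
by move=> ?; apply/andP; split; lra.
Qed.

Lemma integrable_Re_expi (R : realType) (A : set R) (z : R[i]) (r c : R) :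
  measurable A -> A `<=` @Omega R ->
  (@lebesgue_measure R).-integrable A (EFin \o (fun x => complex.Re (z * expi (r * x + c)))).
Proof.
move=> mA /(@Omega_sub3 R) A3; apply: bounded_integrable mA A3 _ _.
  exact: measurable_Re_expi.
by move=> x; exact: Re_expi_bound.
Qed.

(** Orthogonality of characters, from translation invariance rather than an antiderivative. The
    offset [t] matches the density of a rotated state. *)
Lemma Rintegral_Re_expi (R : realType) (z : R[i]) (d : int) (t : R) :
  Rintegral lebesgue_measure (@Omega R) (fun x => complex.Re (z * expi (d%:~R * (x - t)))) =
  2 * pi * ((d == 0)%:R * complex.Re z).
Proof.
have p0 := pi_gt0 R.
case: eqP => [->|/eqP d0].
  under eq_Rintegral do rewrite mul0r expi0 mulr1.
  rewrite Rintegral_cst; last exact: measurable_Omega.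
  have -> : fine (lebesgue_measure (@Omega R)) = 2 * pi :> R.
    rewrite Omega_itv lebesgue_measure_itv /= lte_fin ifT /=; [ring|lra].
  by rewrite mul1r mulrC.
rewrite mul0r mulr0.
pose f x := complex.Re (z * expi (d%:~R * x + - (d%:~R * t))).
have -> : (fun x => complex.Re (z * expi (d%:~R * (x - t)))) = f.
  by apply/funext => x; rewrite /f mulrBr.
have dn0 : d%:~R != 0 :> R by rewrite intr_eq0.
(* Translating by [pi / d] changes the sign of the integrand. *)
have d1 : 1 <= `|d%:~R : R| by rewrite -intr_norm -[1]/(1%:~R) ler_int; lia.
have : `|pi / d%:~R| <= pi :> R.
  rewrite normrM normfV (gtr0_norm p0) ler_pdivrMr ?normr_gt0 //.
  by rewrite ler_peMr // ltW.
rewrite ler_norml => /andP[s1 s2].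
have fB x : `|f x| <= `|complex.Re z| + `|complex.Im z| by exact: Re_expi_bound.
have mf : measurable_fun setT f by exact: measurable_Re_expi.
have fp x : f (x + 2 * pi) = f x.
  rewrite /f; congr complex.Re; congr (_ * _); rewrite -[RHS](expiDint _ d).
  by congr expi; ring.
have := @Rintegral_periodic_translate R (pi / d%:~R) f _ _ _ mf fB fp.
have -> : (fun x => f (x + pi / d%:~R)) = (fun x => (-1) * f x).
  apply/funext => x; rewrite /f.
  have -> : d%:~R * (x + pi / d%:~R) + - (d%:~R * t) = d%:~R * x + - (d%:~R * t) + pi.
    by field.
  by rewrite /expi cosDpi sinDpi; case: (z) => a b /=; ring.
rewrite RintegralZl; [|exact: measurable_Omega|].
  by move=> /(_ ltac:(lra) ltac:(lra)); lra.
apply: integrable_Re_expi => //; exact: measurable_Omega.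
Qed.

(** Integrability comes with the value so that the lemma can be nested for double sums. *)
Lemma Rintegral_sum_ord (R : realType) (A : set R) (N : nat) (f : 'I_N -> R -> R) :
  measurable A -> (forall j, (@lebesgue_measure R).-integrable A (EFin \o f j)) ->
  (@lebesgue_measure R).-integrable A (EFin \o (fun x => \sum_j f j x)) /\
  Rintegral lebesgue_measure A (fun x => \sum_j f j x) =
  \sum_j Rintegral lebesgue_measure A (f j).
Proof.
move=> mA fi; elim: N f fi => [|N IH] f fi.
  under eq_fun do rewrite big_ord0.
  rewrite big_ord0 Rintegral_cst // mul0r; split => //.
  exact: integrable0.
have [i1 i2] := IH (fun j => f (widen_ord (leqnSn N) j)) (fun j => fi _).
under eq_fun do rewrite big_ord_recr /=.
rewrite big_ord_recr /= -i2 RintegralD //; split => //.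
exact: (@integrableD _ _ _ lebesgue_measure A mA _ _ i1 (fi ord_max)).
Qed.

(** * Densities and the measurement M_I *)

Section density.
Context d (T : measurableType d) (R : realType) (mu : {measure set T -> \bar R}).
Context (g : T -> \bar R) (mg : measurable_fun setT g) (g0 : forall x, (0 <= g x)%E).

Lemma density_measure_exists :
  exists nu : {measure set T -> \bar R},
    forall A, measurable A -> nu A = (\int[mu]_(x in A) g x)%E.
Proof.
pose m (A : set T) : \bar R := (\int[mu]_(x in A) g x)%E.
have m0 : m set0 = 0%E by rewrite /m integral_set0.
have mge A : (0 <= m A)%E by apply: integral_ge0.
have madd : semi_sigma_additive m.
  move=> /= F mF tF mUF; rewrite /m ge0_integral_bigcup //; last exact: measurable_funTS.
  by apply: is_cvg_nneseries => i _ _; exact: mge.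
pose mixin := isMeasure.Build _ T R m m0 mge madd.
pose nu : {measure set T -> \bar R} := HB.pack m mixin.
by exists nu.
Qed.

Import HBNNSimple.

Lemma integral_density_nnsfun (nu : {measure set T -> \bar R}) (D : set T) (h : {nnsfun T >-> R}) :
  (forall A, measurable A -> nu A = (\int[mu]_(x in A) g x)%E) -> measurable D ->
  (\int[nu]_(x in D) (h x)%:E = \int[mu]_(x in D) ((h x)%:E * g x))%E.
Proof.
move=> nuE mD.
have mind r : measurable_fun D (fun x => (r * \1_(h @^-1` [set r]) x)%:E).
  exact/measurable_EFinP/measurable_funM.
under eq_integral do rewrite fimfunE -fsumEFin //.
rewrite ge0_integral_fsum //; last by move=> r x _; exact: nnfun_muleindic_ge0.
under [RHS]eq_integral.
  move=> x _; rewrite fimfunE -fsumEFin // ge0_mule_fsuml; last first.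
    by move=> r; exact: nnfun_muleindic_ge0.
  over.
rewrite [RHS]ge0_integral_fsum //; last 2 first.
- by move=> r; apply: emeasurable_funM => //; exact: measurable_funTS.
- by move=> r x _; rewrite mule_ge0 // nnfun_muleindic_ge0.
apply: eq_fsbigr => r /[!inE] -[y _ hy].
have r0 : (0 <= r%:E :> \bar R)%E by rewrite lee_fin -hy.
rewrite integralZl_indic_nnsfun // integral_indic // nuE; last exact: measurableI.
under [RHS]eq_integral do rewrite EFinM -muleA.
rewrite ge0_integralZl //; last 2 first.
- by apply: emeasurable_funM; [exact/measurable_EFinP|exact: measurable_funTS].
- by move=> x _; rewrite mule_ge0 // lee_fin.
congr (_ * _)%E; rewrite setIC integral_mkcondr; apply: eq_integral => x _.
by rewrite patchE indicE; case: ifP => _; rewrite ?mul1e ?mul0e.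
Qed.

(** Simple functions increase to [f], and monotone convergence applies on both sides; finiteness of
    [g] lets the limit pass through the product with [g x]. *)
Lemma integral_density (nu : {measure set T -> \bar R}) (D : set T) (f : T -> \bar R) :
  (forall A, measurable A -> nu A = (\int[mu]_(x in A) g x)%E) -> measurable D ->
  measurable_fun D f -> (forall x, D x -> 0 <= f x)%E -> (forall x, g x \is a fin_num) ->
  (\int[nu]_(x in D) f x = \int[mu]_(x in D) (f x * g x))%E.
Proof.
move=> nuE mD mf f0 gfin; pose h := nnsfun_approx mD mf.
have hf x : D x -> ((h n x)%:E @[n --> \oo] --> f x).
  by move=> Dx; apply: cvg_nnsfun_approx.
have ndh x m n : (m <= n)%N -> ((h m x)%:E <= (h n x)%:E)%E.
  by move=> mn; rewrite lee_fin; exact/lefP/nd_nnsfun_approx.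
have mh (k : nat) (E : set T) : measurable_fun E (fun x => (h k x)%:E).
  exact/measurable_EFinP/measurable_funTS.
have -> : (\int[nu]_(x in D) f x = limn (fun n => \int[nu]_(x in D) (h n x)%:E))%E.
  rewrite -monotone_convergence //=.
  - by apply: eq_integral => x /[!inE] Dx; apply/esym/cvg_lim => //; exact: hf.
  - by move=> n x _; rewrite lee_fin.
  - by move=> x _ m n; exact: ndh.
rewrite (_ : \int[mu]_(x in D) _ = limn (fun n => \int[mu]_(x in D) ((h n x)%:E * g x)))%E.
  by congr (limn _); apply/funext => n; exact: integral_density_nnsfun.
rewrite -monotone_convergence //=.
- apply: eq_integral => x /[!inE] Dx; apply/esym/cvg_lim => //.
  by apply: cvgeZr => //; exact: hf.
- by move=> n; apply: emeasurable_funM => //; exact: measurable_funTS.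
- by move=> n x _; rewrite mule_ge0 // lee_fin.
- by move=> x _ m n mn; rewrite lee_wpmul2r //; exact: ndh.
Qed.

End density.

Section MI.
Context (R : realType) (n : nat).
Implicit Types (sigma rho : 'M[R[i]]_(n.*2.+1)).

(* [2 pi] times the density of the outcome distribution of [M_I] in the state [sigma]. *)
Definition outcome_density sigma (x : R) : R :=
  \sum_j \sum_k complex.Re (sigma j k * expi ((kk R k - kk R j) * x)).

(** The vector [v] is [f(x)|I>]; this quadratic form is how positivity of [sigma] yields a
    nonnegative density. *)
Lemma outcome_densityE sigma (x : R) (v : 'cV[R[i]]_(n.*2.+1)) :
  (forall j, v j 0 = expi (kk R j * x)) ->
  outcome_density sigma x = complex.Re ((adj v *m sigma *m v) 0 0).
Proof.
move=> vE; rewrite mxE Re_sum /outcome_density exchange_big; apply: eq_bigr => k _ /=.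
rewrite mxE mulr_suml Re_sum; apply: eq_bigr => j _.
rewrite mxE !vE conjc_expi [in RHS]mulrAC -expiD [in RHS]mulrC.
by congr (complex.Re (_ * expi _)); ring.
Qed.

Lemma outcome_density_ge0 sigma x : psd sigma -> 0 <= outcome_density sigma x.
Proof.
move=> sp; pose v : 'cV[R[i]]_(n.*2.+1) := \col_j expi (kk R j * x).
rewrite (@outcome_densityE _ _ v); last by move=> j; rewrite mxE.
by have := sp v; rewrite lecE => /andP[].
Qed.

Lemma outcome_density_fU sigma (t x : R) :
  outcome_density (@fU R n t *m sigma *m adj (@fU R n t)) x = outcome_density sigma (x - t).
Proof.
apply: eq_bigr => j _; apply: eq_bigr => k _; rewrite fU_conjE.
by rewrite mulrAC -expiD mulrC; congr (complex.Re (_ * expi _)); ring.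
Qed.

Lemma measurable_outcome_density sigma : measurable_fun setT (outcome_density sigma).
Proof.
apply: measurable_sum => j; apply: measurable_sum => k.
under eq_fun do rewrite -[X in expi X]addr0.
exact: measurable_Re_expi.
Qed.

Lemma integrable_Re_expi0 (A : set R) (z : R[i]) (r : R) :
  measurable A -> A `<=` @Omega R ->
  (@lebesgue_measure R).-integrable A (EFin \o (fun x => complex.Re (z * expi (r * x)))).
Proof.
move=> mA AO; have := @integrable_Re_expi R A z r 0 mA AO.
by under [X in EFin \o X]eq_fun do rewrite addr0.
Qed.

(** A general [z] covers both traces against [sigma] and the identification of complex entries. Its
    two parts are treated separately because [M_I] is given by a cosine and a sine integral. *)
Lemma Re_mulM_I (B : set R) (z : R[i]) j k : measurable B ->
  complex.Re (z * @M_I R n B k j) = (2 * pi)^-1 *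
    Rintegral lebesgue_measure (B `&` @Omega R)
       (fun x => complex.Re (z * expi ((kk R k - kk R j) * x))).
Proof.
move=> mB; have mBO : measurable (B `&` @Omega R).
  by apply: measurableI => //; exact: measurable_Omega.
have BO : B `&` @Omega R `<=` @Omega R by move=> x [].
have ci (a r : R) := @integrable_Re_expi0 _ (Complex a 0) r mBO BO.
have si (a r : R) := @integrable_Re_expi0 _ (Complex 0 a) r mBO BO.
set r := kk R k - kk R j.
have -> : (fun x => complex.Re (z * expi (r * x))) =
    (fun x => complex.Re (Complex (complex.Re z) 0 * expi (r * x))
            + complex.Re (Complex 0 (complex.Im z) * expi (r * x))).
  by apply/funext => x; case: (z) => a b /=; ring.
rewrite RintegralD //.
have -> : (fun x => complex.Re (Complex (complex.Re z) 0 * expi (r * x))) =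
    (fun x => complex.Re z * complex.Re (Complex 1 0 * expi (r * x))).
  by apply/funext => x /=; ring.
have -> : (fun x => complex.Re (Complex 0 (complex.Im z) * expi (r * x))) =
    (fun x => - complex.Im z * complex.Re (Complex 0 (-1) * expi (r * x))).
  by apply/funext => x /=; ring.
rewrite !RintegralZl // mxE.
have -> : (fun x => complex.Re (Complex 1 0 * expi (r * x))) = (fun x => cos (r * x)).
  by apply/funext => x /=; ring.
have -> : (fun x => complex.Re (Complex 0 (-1) * expi (r * x))) = (fun x => sin (r * x)).
  by apply/funext => x /=; ring.
by rewrite -/r; case: z => a b /=; ring.
Qed.

Lemma integrable_outcome_density (A : set R) sigma : measurable A -> A `<=` @Omega R ->
  (@lebesgue_measure R).-integrable A (EFin \o outcome_density sigma).
Proof.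
move=> mA AO; apply: (Rintegral_sum_ord _ _).1 => // j.
by apply: (Rintegral_sum_ord _ _).1 => // k; exact: integrable_Re_expi0.
Qed.

Lemma Re_mxtrace_M_I (B : set R) sigma : measurable B ->
  complex.Re (\tr (sigma *m @M_I R n B)) =
  (2 * pi)^-1 * Rintegral lebesgue_measure (B `&` @Omega R) (outcome_density sigma).
Proof.
move=> mB; have mBO : measurable (B `&` @Omega R).
  by apply: measurableI => //; exact: measurable_Omega.
have BO : B `&` @Omega R `<=` @Omega R by move=> x [].
rewrite Re_mxtraceM (Rintegral_sum_ord _ _).2 //; last first.
  by move=> j; apply: (Rintegral_sum_ord _ _).1 => // k; exact: integrable_Re_expi0.
rewrite mulr_sumr; apply: eq_bigr => j _.
rewrite (Rintegral_sum_ord _ _).2 // => [|k]; last exact: integrable_Re_expi0.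
by rewrite mulr_sumr; apply: eq_bigr => k _; rewrite Re_mulM_I.
Qed.

Lemma EFin_mxtrace_M_I (B : set R) sigma : measurable B ->
  (complex.Re (\tr (sigma *m @M_I R n (B `&` @Omega R))))%:E =
  (\int[lebesgue_measure]_(x in B `&` @Omega R) ((2 * pi)^-1 * outcome_density sigma x)%:E)%E.
Proof.
move=> mB; have mBO : measurable (B `&` @Omega R).
  by apply: measurableI => //; exact: measurable_Omega.
have BO : B `&` @Omega R `<=` @Omega R by move=> x [].
rewrite Re_mxtrace_M_I // -setIA setIid -RintegralZl //; last exact: integrable_outcome_density.
rewrite /Rintegral fineK //; apply: integrable_fin_num => //.
exact: (@integrableZl _ _ _ lebesgue_measure _ mBO (2 * pi)^-1 _
  (integrable_outcome_density sigma mBO BO)).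
Qed.

Lemma outcome_density_measurable_EFin sigma :
  measurable_fun setT (fun x : R => ((2 * pi)^-1 * outcome_density sigma x)%:E).
Proof.
by apply/measurable_EFinP/measurable_funM => //; exact: measurable_outcome_density.
Qed.

Lemma outcome_density_EFin_ge0 sigma x : psd sigma ->
  (0 <= ((2 * pi)^-1 * outcome_density sigma x)%:E)%E.
Proof.
by move=> sp; rewrite lee_fin mulr_ge0 ?outcome_density_ge0 // invr_ge0 mulr_ge0 ?pi_ge0.
Qed.

(* [lebesgue_measure] lives on [measurableTypeR R], whose display differs from the one of
   [R] used by [outcome_measure]; [pushforward] along the identity changes the display. *)
Definition to_R (x : measurableTypeR R) : R := x.

Lemma measurable_to_R : measurable_fun setT to_R.
Proof. by move=> _ B mB; rewrite setTI. Qed.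

Lemma outcome_measure_M_I_exists sigma : psd sigma ->
  exists mu : {measure set R -> \bar R}, outcome_measure sigma (@M_I R n) mu.
Proof.
move=> sp.
have [nu nuE] := @density_measure_exists _ _ _ lebesgue_measure _
  (outcome_density_measurable_EFin sigma) (fun x => outcome_density_EFin_ge0 x sp).
(* [outcome_measure] sees only the part of [B] inside [Omega], hence the restriction. *)
pose nuO := mrestr nu (@measurable_Omega R).
exists (pushforward nuO to_R) => B mB.
by rewrite EFin_mxtrace_M_I // -nuE //; apply: measurableI => //; exact: measurable_Omega.
Unshelve. exact: measurable_to_R.
Qed.

Lemma integral_outcome_M_I sigma (mu : {measure set R -> \bar R}) (f : R -> R) :
  psd sigma -> outcome_measure sigma (@M_I R n) mu ->
  measurable_fun setT f -> (forall x, 0 <= f x) ->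
  (\int[mu]_(x in @Omega R) (f x)%:E =
   \int[lebesgue_measure]_(x in @Omega R) (f x * ((2 * pi)^-1 * outcome_density sigma x))%:E)%E.
Proof.
move=> sp muM mf f0.
have [nu nuE] := @density_measure_exists _ _ _ lebesgue_measure _
  (outcome_density_measurable_EFin sigma) (fun x => outcome_density_EFin_ge0 x sp).
pose mfm := isMeasurableFun.Build _ _ _ _ _ measurable_to_R.
pose h : {mfun measurableTypeR R >-> R} := HB.pack to_R mfm.
transitivity (\int[pushforward nu h]_(x in @Omega R) (f x)%:E)%E.
  (* The unrestricted density measure agrees with [mu] on subsets of [Omega], which is all that an
     integral over [Omega] involves. *)
  apply: eq_measure_integral => B mB BO.
  have -> : mu B = (complex.Re (\tr (sigma *m @M_I R n (B `&` @Omega R))))%:E by exact: muM.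
  rewrite EFin_mxtrace_M_I // (setIidl BO) /pushforward nuE //.
rewrite ge0_integral_pushforward //.
- rewrite (@integral_density _ _ _ lebesgue_measure _ (outcome_density_measurable_EFin sigma)
    (fun x => outcome_density_EFin_ge0 x sp)) //.
  + exact: measurable_Omega.
  + by apply/measurable_EFinP; exact: measurable_funS mf.
  + by move=> x _; rewrite lee_fin.
- exact: measurable_Omega.
- by apply/measurable_EFinP; exact: measurable_funS mf.
- by move=> x _; rewrite lee_fin.
Qed.

(** Product-to-sum leaves three characters per entry and integration keeps those of frequency 0; the
    surviving weights are exactly [risk_coef], whatever [t] is. *)
Lemma integral_risk_density sigma (t : R) :
  (\int[lebesgue_measure]_(x in @Omega R)
     ((1 - cos (x - t)) * ((2 * pi)^-1 * outcome_density sigma (x - t)))%:E)%E =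
  (\sum_j \sum_k risk_coef R j k * complex.Re (sigma j k))%:E.
Proof.
have mO := @measurable_Omega R; have p0 := pi_gt0 R.
have ie (z : R[i]) (d : int) :
    (@lebesgue_measure R).-integrable (@Omega R)
      (EFin \o (fun x => complex.Re (z * expi (d%:~R * (x - t))))).
  have := @integrable_Re_expi R (@Omega R) z d%:~R (- (d%:~R * t)) mO (fun x Ox => Ox).
  by under [X in EFin \o X]eq_fun do rewrite -mulrBr.
pose D (j k : 'I_(n.*2.+1)) : int := (k : int) - (j : int).
pose F j k x := complex.Re (sigma j k * expi ((D j k)%:~R * (x - t)))
  - 2^-1 * (complex.Re (sigma j k * expi ((D j k + 1)%:~R * (x - t)))
          + complex.Re (sigma j k * expi ((D j k - 1)%:~R * (x - t)))).
have iD j k : (@lebesgue_measure R).-integrable (@Omega R)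
    (EFin \o (fun x => complex.Re (sigma j k * expi ((D j k + 1)%:~R * (x - t)))
          + complex.Re (sigma j k * expi ((D j k - 1)%:~R * (x - t))))).
  exact: (@integrableD _ _ _ lebesgue_measure _ mO _ _ (ie _ _) (ie _ _)).
have iZ j k : (@lebesgue_measure R).-integrable (@Omega R)
    (EFin \o (fun x => 2^-1 * (complex.Re (sigma j k * expi ((D j k + 1)%:~R * (x - t)))
          + complex.Re (sigma j k * expi ((D j k - 1)%:~R * (x - t)))))).
  exact: (@integrableZl _ _ _ lebesgue_measure _ mO _ _ (iD j k)).
have iF j k : (@lebesgue_measure R).-integrable (@Omega R) (EFin \o F j k).
  exact: (@integrableB _ _ _ lebesgue_measure _ mO _ _ (ie _ _) (iZ j k)).
have iS j := Rintegral_sum_ord mO (iF j).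
have [iSS eSS] := Rintegral_sum_ord mO (fun j => (iS j).1).
have E x : (1 - cos (x - t)) * ((2 * pi)^-1 * outcome_density sigma (x - t)) =
    (2 * pi)^-1 * \sum_j \sum_k F j k x.
  rewrite mulrCA; congr (_ * _); rewrite mulr_sumr; apply: eq_bigr => j _.
  rewrite mulr_sumr; apply: eq_bigr => k _.
  by rewrite kkB riskM_expi.
under eq_integral do rewrite E.
transitivity (((2 * pi)^-1 *
    Rintegral lebesgue_measure (@Omega R) (fun x => \sum_j \sum_k F j k x))%:E).
  rewrite -RintegralZl // /Rintegral fineK //; apply: integrable_fin_num => //.
  exact: (@integrableZl _ _ _ lebesgue_measure _ mO _ _ iSS).
rewrite eSS mulr_sumr; congr _%:E; apply: eq_bigr => j _.
rewrite (iS j).2 mulr_sumr; apply: eq_bigr => k _.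
rewrite RintegralB // RintegralZl // RintegralD // !Rintegral_Re_expi risk_coefE -/(D j k).
move: (_ == 0)%:R (_ + 1 == 0)%:R (_ - 1 == 0)%:R => a b c.
have pV : (2 * pi)^-1 * (2 * pi) = 1 :> R by rewrite mulVf // gt_eqF // mulr_gt0.
transitivity ((2 * pi)^-1 * (2 * pi) * ((a - 2^-1 * (b + c)) * complex.Re (sigma j k))).
  by ring.
by rewrite pV mul1r.
Qed.

Lemma outcome_risk_M_I rho (t : R) (mu : {measure set R -> \bar R}) : psd rho ->
  outcome_measure (@fU R n t *m rho *m adj (@fU R n t)) (@M_I R n) mu ->
  (\int[mu]_(x in @Omega R) (1 - cos (x - t))%:E)%E =
  (\sum_j \sum_k risk_coef R j k * complex.Re (rho j k))%:E.
Proof.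
move=> rp muM.
rewrite (integral_outcome_M_I (psd_fU_conj t rp) muM (f := fun x => 1 - cos (x - t))).
- by under eq_integral do rewrite outcome_density_fU; exact: integral_risk_density.
- by apply/measurable_EFinP; exact: measurable_risk.
- by move=> x; rewrite subr_ge0 cos_le1.
Qed.

(** The expected risk is the same at every parameter, so the supremum runs over a single value;
    existence of an outcome measure shows that it is taken. *)
Lemma DR_M_I rho : psd rho ->
  DR rho (@M_I R n) = (\sum_j \sum_k risk_coef R j k * complex.Re (rho j k))%:E.
Proof.
move=> rp; rewrite /DR [X in ereal_sup X](_ : _ =
    [set (\sum_j \sum_k risk_coef R j k * complex.Re (rho j k))%:E]) ?ereal_sup1 //.
apply/seteqP; split => r /=.
  by move=> [t [mu [_ muM ->]]]; exact: outcome_risk_M_I.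
move=> ->; have [mu muM] := outcome_measure_M_I_exists (psd_fU_conj 0 rp).
exists 0, mu; split => //; last by rewrite (outcome_risk_M_I rp muM).
by apply/andP; split; have := pi_gt0 R; lra.
Qed.

Lemma sqn_Finv (phi : 'cV[R[i]]_(n.*2.+1)) (x : R) :
  sqn (Finv phi x) = outcome_density (phi *m adj phi) x.
Proof.
have sqnE (z : R[i]) : sqn z = complex.Re (z * conjc z).
  by case: z => a b; rewrite /sqn /=; ring.
rewrite sqnE /Finv rmorph_sum mulr_suml Re_sum; apply: eq_bigr => j _.
rewrite mulr_sumr Re_sum; apply: eq_bigr => k _.
transitivity (complex.Re (expi (- (kk R j * x)) * phi j 0 *
    (expi (kk R k * x) * conjc (phi k 0)))).
  have cM (u v : R[i]) : conjc (u * v) = conjc u * conjc v by exact: rmorphM.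
  have e : conjc (expi (- (kk R k * x)) * phi k 0) = expi (kk R k * x) * conjc (phi k 0).
    by rewrite cM conjc_expi opprK.
  by rewrite -e.
rewrite mxE big_ord1 mxE mulrACA -expiD [X in complex.Re X = _]mulrC.
by congr (complex.Re (_ * expi _)); ring.
Qed.

(** The squared modulus of [Finv phi] is the outcome density of the pure state, so this is the risk
    integral at parameter 0. *)
Lemma DRvecE (phi : 'cV[R[i]]_(n.*2.+1)) :
  DRvec phi = (\sum_j \sum_k risk_coef R j k * complex.Re ((phi *m adj phi) j k))%:E.
Proof.
have c0 : 0 <= (2 * pi)^-1 :> R by rewrite invr_ge0 mulr_ge0 ?pi_ge0.
rewrite -(integral_risk_density _ 0) /DRvec -ge0_integralZl //=.
- apply: eq_integral => x _; rewrite -EFinM subr0 sqn_Finv; congr _%:E; ring.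
- exact: measurable_Omega.
- apply/measurable_EFinP/measurable_funM.
    have := @measurable_risk R (@Omega R) 0 => /measurable_EFinP.
    by under eq_fun do rewrite subr0.
  under eq_fun do rewrite sqn_Finv.
  by apply: measurable_funTS; exact: measurable_outcome_density.
- move=> x _; rewrite lee_fin mulr_ge0 ?subr_ge0 ?cos_le1 //.
  by rewrite addr_ge0 // sqr_ge0.
Qed.

End MI.

(** Reduces identities between entries of [M_I] to real integrals, to which [Re_mulM_I] applies. *)
Lemma complex_eq_Re (R : realType) (x y : R[i]) :
  (forall w, complex.Re (w * x) = complex.Re (w * y)) -> x = y.
Proof.
case: x => a b; case: y => c d e; have := e (Complex 1 0); have := e (Complex 0 (-1)).
by rewrite /= => h1 h2; congr Complex; lra.
Qed.

(** * Periodization of sets and covariance of [M_I] *)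

Section periodization.
Context (R : realType).

(** Turns translation modulo [2 * pi] into ordinary translation of a periodic set. *)
Definition periodize (B : set R) : set R := [set x | exists k : int, B (x - k%:~R * (2 * pi))].

Lemma measurable_periodize (B : set R) : measurable B -> measurable (periodize B).
Proof.
move=> mB; rewrite [periodize B](_ : _ =
    \bigcup_(k : int) ((fun x : R => x - k%:~R * (2 * pi)) @^-1` B)).
  apply: countable_bigcupT_measurable => // k.
  rewrite -[X in measurable X]setTI.
  have mf : measurable_fun setT (fun x : R => x - k%:~R * (2 * pi)).
    exact: measurable_funB.
  exact: mf.
by apply/seteqP; split => x /= [k]; [move=> Bk; exists k|move=> _ Bk; exists k].
Qed.

Lemma shiftE (B : set R) (t : R) :
  Defs.shift B t = @Omega R `&` [set x | periodize B (x - t)].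
Proof.
apply/seteqP; split => x /= [xO].
  move=> [b [k [Bb xE]]]; split => //; exists k.
  by have -> : x - t - k%:~R * (2 * pi) = b by rewrite xE; ring.
move=> [k Bk]; split => //; exists (x - t - k%:~R * (2 * pi)), k; split => //.
ring.
Qed.

Lemma Omega_periodize (B : set R) : B `<=` @Omega R -> @Omega R `&` periodize B = B.
Proof.
move=> BO; apply/seteqP; split => x /=; last first.
  by move=> Bx; split; [exact: BO|exists 0; rewrite mul0r subr0].
move=> [xO [k Bk]]; have k0 : k = 0.
  by apply: (Omega_shift_eq xO (BO _ Bk)); ring.
by move: Bk; rewrite k0 mul0r subr0.
Qed.

Lemma periodizeD2pi (B : set R) x : periodize B (x + 2 * pi) = periodize B x.
Proof.
apply/propext; split => -[k Bk].
  exists (k - 1); have -> // : x - (k - 1)%:~R * (2 * pi) = x + 2 * pi - k%:~R * (2 * pi).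
  by rewrite intrB; ring.
exists (k + 1); have -> // : x + 2 * pi - (k + 1)%:~R * (2 * pi) = x - k%:~R * (2 * pi).
by rewrite intrD; ring.
Qed.

Lemma Rintegral_setI_patch (D P : set R) (f : R -> R) :
  Rintegral lebesgue_measure (D `&` P) f = Rintegral lebesgue_measure D (f \_ P).
Proof.
rewrite /Rintegral integral_mkcondr; congr fine; apply: eq_integral => x _.
by rewrite !patchE; case: ifP.
Qed.

Lemma measurable_shift (B : set R) (t : R) : measurable B -> measurable (Defs.shift B t).
Proof.
move=> mB; rewrite shiftE; apply: measurableI; first exact: measurable_Omega.
have mf : measurable_fun setT (fun x : R => x - t) by exact: measurable_funB.
by rewrite -[X in measurable X]setTI; apply: mf => //; exact: measurable_periodize.
Qed.

(** Cutting [f] off outside the translated periodic set leaves a periodic function, so invariance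
    over the full circle gives the claim for [B]. *)
Lemma Rintegral_shift (B : set R) (t : R) (f : R -> R) (K : R) :
  Omega t -> measurable B -> B `<=` @Omega R ->
  measurable_fun setT f -> (forall x, `|f x| <= K) -> (forall x, f (x + 2 * pi) = f x) ->
  Rintegral lebesgue_measure (Defs.shift B t) f =
  Rintegral lebesgue_measure B (fun x => f (x + t)).
Proof.
move=> /andP[t1 t2] mB BO mf fK fp; have p0 := pi_gt0 R.
pose P := [set x | periodize B (x - t)].
have mP : measurable P.
  have mh : measurable_fun setT (fun x : R => x - t) by exact: measurable_funB.
  by rewrite -[X in measurable X]setTI; apply: mh => //; exact: measurable_periodize.
have K0 : 0 <= K by apply: le_trans (fK 0).
rewrite shiftE Rintegral_setI_patch.
rewrite -(@Rintegral_periodic_translate R t (f \_ P) K); [|lra|lra| | |].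
- rewrite -[in RHS](Omega_periodize BO) Rintegral_setI_patch; congr Rintegral.
  apply/funext => x; rewrite !patchE.
  have -> : (x + t \in P) = (x \in periodize B) by apply/idP/idP; rewrite !inE /P /= addrK.
  by [].
- by apply/(measurable_restrictT f mP); exact: measurable_funS mf.
- by move=> x; rewrite patchE; case: ifP => // _; rewrite normr0.
move=> x; rewrite !patchE fp.
have -> // : (x + 2 * pi \in P) = (x \in P).
have e : (P (x + 2 * pi)) = P x by rewrite /P /= -(periodizeD2pi B (x - t)) addrAC.
by apply/idP/idP; rewrite !inE e.
Qed.

End periodization.

Section covariance.
Context (R : realType) (n : nat).

Lemma adj_M_I (B : set R) : measurable B -> adj (@M_I R n B) = @M_I R n B.
Proof.
move=> mB; have mBO : measurable (B `&` @Omega R).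
  by apply: measurableI => //; exact: measurable_Omega.
have BO : B `&` @Omega R `<=` @Omega R by move=> x [].
apply/matrixP => j k; rewrite !mxE /=; congr (Complex (_ * Rintegral _ _ _) _).
  by apply/funext => x; rewrite -cosN; congr cos; ring.
rewrite -mulrN; congr (_ * _); rewrite -mulN1r.
have -> : (fun x => sin ((kk R k - kk R j) * x)) =
    (fun x => complex.Re (Complex 0 (-1) * expi ((kk R k - kk R j) * x))).
  by apply/funext => x /=; ring.
rewrite -RintegralZl //; last exact: integrable_Re_expi0.
congr Rintegral; apply/funext => x /=.
have -> : (kk R j - kk R k) * x = - ((kk R k - kk R j) * x) by ring.
by rewrite sinN; ring.
Qed.

(** The form is real because [M_I] of a set is self-adjoint, and its real part is a trace against
    [v *m adj v], the integral of a nonnegative density. *)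
Lemma psd_M_I (B : set R) : measurable B -> psd (@M_I R n B).
Proof.
move=> mB v; have mBO : measurable (B `&` @Omega R).
  by apply: measurableI => //; exact: measurable_Omega.
have adjE : conjc ((adj v *m @M_I R n B *m v) 0 0) = (adj v *m @M_I R n B *m v) 0 0.
  have e : adj (adj v *m @M_I R n B *m v) = adj v *m @M_I R n B *m v.
    by rewrite !adjM adjK adj_M_I // mulmxA.
  by move/matrixP: e => /(_ 0 0); rewrite mxE.
rewrite lecE; apply/andP; split.
  by move: adjE; case: ((adj v *m _ *m v) 0 0) => a b /= [] e; apply/eqP; lra.
have -> : (adj v *m @M_I R n B *m v) 0 0 = \tr (v *m adj v *m @M_I R n B).
  by rewrite -[in RHS]mulmxA [RHS]mxtrace_mulC /mxtrace big_ord1.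
rewrite Re_mxtrace_M_I // mulr_ge0 ?invr_ge0 ?mulr_ge0 ?pi_ge0 //.
apply: Rintegral_ge0 => x _; exact: outcome_density_ge0 (psd_outer v).
Qed.

Lemma M_I_Omega : @M_I R n (@Omega R) = 1%:M.
Proof.
apply/matrixP => k j; apply: complex_eq_Re => w.
rewrite Re_mulM_I; last exact: measurable_Omega.
rewrite setIid kkB.
have -> : (fun x : R => complex.Re (w * expi (((k : int) - (j : int))%:~R * x))) =
    (fun x => complex.Re (w * expi (((k : int) - (j : int))%:~R * (x - 0)))).
  by apply/funext => x; rewrite subr0.
rewrite Rintegral_Re_expi mulKf; last by rewrite mulf_neq0 ?pnatr_eq0 // gt_eqF ?pi_gt0.
rewrite !mxE subr_eq0 -[(_ == _ :> int)]/(k == j); case: (k == j).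
  by rewrite mul1r mulr1n mulr1.
by rewrite mul0r mulr0n mulr0.
Qed.

(** Conjugation multiplies the [(k, j)] entry by a phase that translates the character under the
    integral by [t]; [Rintegral_shift] moves this translation to the set. *)
Lemma covariant_M_I : covariant (@M_I R n).
Proof.
split; first split.
- by move=> B mB _; exact: psd_M_I.
- exact: M_I_Omega.
- by move=> sigma; exact: outcome_measure_M_I_exists.
move=> t B tO mB BO; apply/matrixP => k j; apply: complex_eq_Re => w.
rewrite fU_conjE mulrA !Re_mulM_I //; last exact: measurable_shift.
rewrite (setIidl BO) setIidl; last by move=> x [].
congr (_ * _); rewrite (@Rintegral_shift _ _ _ _ (`|complex.Re w| + `|complex.Im w|)) //.
- congr Rintegral; apply/funext => x; rewrite -mulrA -expiD.
  by congr (complex.Re (_ * expi _)); ring.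
- under eq_fun do rewrite -[X in expi X]addr0.
  exact: measurable_Re_expi.
- by move=> x; exact: Re_expi_bound.
move=> x; rewrite kkB -[in RHS](@expiDint R _ ((k : int) - (j : int))).
by congr (complex.Re (_ * expi _)); ring.
Qed.

End covariance.

(** * Attainment, randomized strategies and the theorem *)

Lemma sine_unit_vec (R : realType) (n : nat) : exists phi : 'cV[R[i]]_(n.*2.+1),
  unit_vec phi /\ exists C : R[i], forall j, phi j 0 = C * Complex (sine_state R j) 0.
Proof.
pose S : R := \sum_(j < n.*2.+1) sine_state R j ^+ 2.
have S0 : 0 < S.
  rewrite /S (bigD1 ord0) //= ltr_pwDl ?exprn_gt0 ?sine_state_gt0 //.
  by apply: sumr_ge0 => j _; exact: sqr_ge0.
pose C := (Num.sqrt S)^-1.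
exists (\col_j (Complex C 0 * Complex (sine_state R j) 0)); split; last first.
  by exists (Complex C 0) => j; rewrite mxE.
rewrite /unit_vec; have -> : 1 = C ^+ 2 * S :> R.
  by rewrite /C exprVn sqr_sqrtr ?ltW // mulVf // gt_eqF.
rewrite mulr_sumr; apply: eq_bigr => j _; rewrite mxE sqnM /sqn /=; ring.
Qed.

Lemma minrisk_ge0 (R : realType) (n : nat) : 0 <= minrisk R n.
Proof. by rewrite subr_ge0 cos_le1. Qed.

(** Since the weights sum to 1, [r] is itself the series of the [r * p i], which is compared
    termwise. *)
Lemma randomized_ge (R : realType) (p : nat -> R) (D : nat -> \bar R) (r : R) :
  is_prob p -> 0 <= r -> (forall i, (r%:E <= D i)%E) ->
  (r%:E <= \sum_(0 <= i <oo) ((p i)%:E * D i))%E.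
Proof.
move=> [p0 p1] r0 rD; have -> : r%:E = (\sum_(0 <= i <oo) (r%:E * (p i)%:E))%E.
  by rewrite nneseriesZl ?p1 ?mule1 // => i _; rewrite lee_fin.
apply: lee_nneseries => [i _ _|i _].
  by rewrite mule_ge0 // lee_fin.
by rewrite muleC lee_wpmul2l // lee_fin.
Qed.

Theorem theorem7 (R : realType) (n : nat) :
  [/\
   (* min_rho min_{M cov} D_R(rho, M) = 1 - cos(pi/(2n+2)) *)
   (exists (rho : 'M[R[i]]_(n.*2.+1)) (M : set R -> 'M[R[i]]_(n.*2.+1)),
      [/\ is_state rho, covariant M & DR rho M = (@minrisk R n)%:E]) /\
   (forall (rho : 'M[R[i]]_(n.*2.+1)) (M : set R -> 'M[R[i]]_(n.*2.+1)),
      is_state rho -> covariant M -> ((@minrisk R n)%:E <= DR rho M)%E),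
   (* min over randomized strategies {p_i, rho_i, M_i} *)
   (exists (p : nat -> R) (rhos : nat -> 'M[R[i]]_(n.*2.+1))
           (Ms : nat -> set R -> 'M[R[i]]_(n.*2.+1)),
      [/\ is_prob p, (forall i, is_state (rhos i) /\ covariant (Ms i)) &
          (\sum_(0 <= i <oo) ((p i)%:E * DR (rhos i) (Ms i)))%E = (@minrisk R n)%:E])
   /\
   (forall (p : nat -> R) (rhos : nat -> 'M[R[i]]_(n.*2.+1))
           (Ms : nat -> set R -> 'M[R[i]]_(n.*2.+1)),
      is_prob p -> (forall i, is_state (rhos i) /\ covariant (Ms i)) ->
      ((@minrisk R n)%:E <= \sum_(0 <= i <oo) ((p i)%:E * DR (rhos i) (Ms i)))%E),
   (* min over unit vectors of D_R(|phi>) *)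
   (exists phi : 'cV[R[i]]_(n.*2.+1), unit_vec phi /\ DRvec phi = (@minrisk R n)%:E) /\
   (forall phi : 'cV[R[i]]_(n.*2.+1), unit_vec phi -> ((@minrisk R n)%:E <= DRvec phi)%E),
   (* M_{|I><I|} is a covariant POVM *)
   covariant (@M_I R n) &
   (* characterization of the optimal input states for M_{|I><I|} *)
   forall phi : 'cV[R[i]]_(n.*2.+1), unit_vec phi ->
     (DR (phi *m adj phi) (@M_I R n) = (@minrisk R n)%:E <->
      exists C : R[i], forall j, phi j 0 = C * Complex (@sine_state R n j) 0)].

Proof.
have [phi [phi1 phiC]] := sine_unit_vec R n.
have phiE := (unit_vec_risk_eq phi1).2 phiC.
have DRphi : DR (phi *m adj phi) (@M_I R n) = (minrisk R n)%:E.
  by rewrite DR_M_I ?phiE //; exact: psd_outer.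
have cM := covariant_M_I R n.
have srho := state_outer phi1.
split; [split|split|split|exact: cM|].
- by exists (phi *m adj phi), (@M_I R n); split; [exact: srho|exact: cM|exact: DRphi].
- by move=> rho M; exact: DR_ge.
(* All weight on index 0 reproduces the deterministic optimum. *)
- exists (fun i => (i == 0%N)%:R), (fun=> phi *m adj phi), (fun=> @M_I R n); split.
  + split=> [i|]; first exact: ler0n.
    rewrite nneseries_recl /= => [|k _|]; [|by rewrite lee_fin ler0n|by []].
    by rewrite eseries0 ?adde0 // => -[].
  + by move=> i; split; [exact: srho|exact: cM].
  rewrite DRphi nneseries_recl /= => [|k _|];
    [|by rewrite mule_ge0 // lee_fin ?ler0n ?minrisk_ge0|by []].
  by rewrite mul1e eseries0 ?adde0 // => -[//|k] _ _; rewrite mul0e.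
- move=> p rhos Ms pp st; apply: randomized_ge; [exact: pp|exact: minrisk_ge0|move=> i].
  by apply: DR_ge; [exact: (st i).1|exact: (st i).2].
- by exists phi; split; [exact: phi1|rewrite DRvecE phiE].
- by move=> psi u; rewrite DRvecE lee_fin; exact: unit_vec_risk_ge.
(* The unit norm of [psi] fixes the modulus of [C] and leaves a global phase. *)
move=> psi u; rewrite DR_M_I; last exact: psd_outer.
by apply: iff_trans (unit_vec_risk_eq u); split=> [[]|->].
Qed.
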